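(* Suppose that: (G1) there exists $s_0\in\mathbb{R}$ such that $G(s_0)<0$; (G2) there exist constants $C>0$, $p,q,p_*,s_*$ with $2<p_*<6$ and $2<p\le q$ such that $|G'(s)|\le C(|s|^{p-1}+|s|^{q-1})$ for all $s\in\mathbb{R}$ and $-C|s|^{p_*-1}\le G'(s)$ for all $s\ge s_*$; (G3) $G$ is $C^2$ and $12G(R(x))-7R(x)G'(R(x))+R(x)^2G''(R(x))\ge 0$ for every $x\in\mathbb{R}$, every $\omega\in\mathbb{R}$ and every real-valued $R\in H^1(\mathbb{R})$ solving $-R''+G'(R)+\omega R=0$; (G4) $|G''(s)|\le C(|s|^{p-2}+|s|^{q-2})$ for every $s\in\mathbb{R}$, with $p,q$ as in (G2). Let $\lambda>\lambda_*$. Then the set $\mathcal{G}_\lambda\cap H^1_r(\mathbb{R})$ is finite.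
   Context: Let $f:\mathbb{C}\to\mathbb{C}$ be $C^1$ (in the real sense) with $f(\overline{s})=\overline{f(s)}$ and $f(zs)=zf(s)$ for all $s,z\in\mathbb{C}$ with $|z|=1$. Then $f$ maps $\mathbb{R}$ to $\mathbb{R}$; let $G$ be the primitive of $f|_{\mathbb{R}}$ with $G(0)=0$, and $F(s)=G(|s|)$ for $s\in\mathbb{C}$. On $H^1(\mathbb{R};\mathbb{C})$ put $$E(u)=\frac12\int_{\mathbb{R}}|u'|^2dx+\int_{\mathbb{R}}F(u)\,dx,\qquad M(u)=\int_{\mathbb{R}}|u|^2dx.$$ For $\lambda>0$ let $S(\lambda)=\{u\in H^1(\mathbb{R};\mathbb{C}):M(u)=\lambda\}$, $I(\lambda)=\inf_{S(\lambda)}E$ and $\mathcal{G}_\lambda=\{u\in S(\lambda):E(u)=I(\lambda)\}$. The number $\lambda_*\ge0$ is $\lambda_*=\sup\{\lambda>0: I(\lambda)=0\}$ (with $\lambda_*=0$ if this set is empty); thus $I=0$ on $(0,\lambda_*]$ and $I<0$ on $(\lambda_*,\infty)$. $H^1_r(\mathbb{R})$ is the space of real-valued even functions in $H^1(\mathbb{R})$. *)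

(* Defs.v *)
From HB Require Import structures.
From mathcomp Require Import all_boot all_order all_algebra.
From mathcomp Require Export complex.
From mathcomp Require Import all_classical all_reals all_analysis.

Set Implicit Arguments.
Unset Strict Implicit.
Unset Printing Implicit Defensive.

Import Order.TTheory GRing.Theory Num.Theory.
Import numFieldNormedType.Exports.
Local Open Scope ring_scope.
Local Open Scope classical_set_scope.

Definition realify (R : realType) (f : R[i] -> R[i]) (z : R * R) : R * R :=
  (complex.Re (f (Complex z.1 z.2)), complex.Im (f (Complex z.1 z.2))).

(* C^1 in the real sense; as R^2 is finite dimensional, continuity of the
   differential is continuity of its value on each vector. *)
Definition real_C1 (R : realType) (f : R[i] -> R[i]) : Prop :=
  (forall z, differentiable (realify f) z) /\
  (forall v, continuous (fun z => 'd (realify f) z v)).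

Definition C2 (R : realType) (G : R -> R) : Prop :=
  [/\ forall x, derivable G x 1, forall x, derivable (derive1 G) x 1
    & continuous (derive1n 2 G)].

(* C^1 test functions with compact support, as in Brezis, Functional Analysis,
   Sobolev Spaces and PDE, section 8.2. *)
Definition test_fun (R : realType) (phi : R -> R) : Prop :=
  [/\ forall x, derivable phi x 1, continuous (derive1 phi)
    & exists M : R, forall x, M < `|x| -> phi x = 0].

Definition is_wderiv (R : realType) (u v : R -> R) : Prop :=
  [/\ locally_integrable setT u, locally_integrable setT v
    & forall phi : R -> R, test_fun phi ->
      \int[lebesgue_measure]_x (u x * derive1 phi x) =
      - \int[lebesgue_measure]_x (v x * phi x)].

(* A weak derivative of u, if there is one; it is unique up to null sets. *)
Definition wderiv (R : realType) (u : R -> R) : R -> R :=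
  xget (cst 0) (is_wderiv u).

(* An element of H^1(R) is given by its unique continuous representative, so
   that equality in H^1 is equality of functions. *)
Definition H1 (R : realType) : set (R -> R) :=
  [set u : R -> R | [/\ continuous u, u \in Lfun lebesgue_measure 2%:E
    & exists2 v, v \in Lfun lebesgue_measure 2%:E & is_wderiv u v]].

Definition H1C (R : realType) : set (R -> R[i]) :=
  [set u : R -> R[i] | H1 (@complex.Re R \o u) /\ H1 (@complex.Im R \o u)].

Definition wderivC (R : realType) (u : R -> R[i]) (x : R) : R[i] :=
  Complex (wderiv (@complex.Re R \o u) x) (wderiv (@complex.Im R \o u) x).

Definition H1r (R : realType) : set (R -> R[i]) :=
  [set u : R -> R[i] | [/\ H1C u, forall x, complex.Im (u x) = 0
    & forall x, u (- x) = u x]].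

(* - Q'' + G'(Q) + omega Q = 0 in the weak sense. *)
Definition solves (R : realType) (G : R -> R) (omega : R) (Q : R -> R) : Prop :=
  is_wderiv (wderiv Q) (fun x => derive1 G (Q x) + omega * Q x).

Section Minimization.
Context (R : realType).
Variable G : R -> R.
Local Open Scope ereal_scope.

Definition F (s : R[i]) : R := G (Normc.normc s).

Definition energy (u : R -> R[i]) : \bar R :=
  2^-1%:E * \int[lebesgue_measure]_x (Normc.normc (wderivC u x) ^+ 2)%:E
  + \int[lebesgue_measure]_x (F (u x))%:E.

Definition mass (u : R -> R[i]) : \bar R :=
  \int[lebesgue_measure]_x (Normc.normc (u x) ^+ 2)%:E.

Definition mass_sphere (lambda : R) : set (R -> R[i]) :=
  [set u : R -> R[i] | H1C u /\ mass u = lambda%:E].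

Definition inf_energy (lambda : R) : \bar R :=
  ereal_inf (energy @` mass_sphere lambda).

Definition minimizers (lambda : R) : set (R -> R[i]) :=
  [set u : R -> R[i] | mass_sphere lambda u /\ energy u = inf_energy lambda].

(* The point 0 yields the convention that the supremum of the empty set is 0. *)
Definition lambda_star : \bar R :=
  ereal_sup ([set 0] `|`
    EFin @` [set lambda : R | (0 < lambda)%R /\ inf_energy lambda = 0]).

End Minimization.

(* Main.v *)
(* A real minimizer solves -q'' + G'(q) + w q = 0 and, up to sign, is an even
   positive solution with q'^2 = 2 q^2 (g(q) - g(a)), where g(s) = G(s) / s^2
   and a = q(0). Hypothesis (G3) says that g'(s) / s^3 is nondecreasing along
   the solution; as g'(a) < 0, g is decreasing on ]0, a] and q decreases from a
   to 0 on [0, +oo[. The mass-critical rescaling W(y) = q(y / a^2) / a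
   preserves the mass and turns the equation into
   W'^2 = 2 W^2 (g(a W) - g(a)) / a^4, whose right-hand side is nonincreasing
   in a by (G3). Hence a smaller height gives a smaller W, and two solutions of
   equal mass have the same W. If their heights differ, g'(s) / s^3 is constant
   on ]0, a[, so that s G'(s) = 6 G(s): then the energy density is the
   derivative of q q' / 4 and the energy vanishes, which contradicts
   I(lambda) <> 0. So there are at most two minimizers, q and -q. *)

Require Import Defs.
From mathcomp Require Import all_boot all_order all_algebra.
From mathcomp Require Import complex.
From mathcomp Require Import all_classical all_reals all_analysis.
From mathcomp Require Import measurable_realfun.
From mathcomp Require Import ring lra.

Import Order.TTheory GRing.Theory Num.Theory.
Import numFieldNormedType.Exports.
Local Open Scope ring_scope.
Local Open Scope classical_set_scope.

Set Implicit Arguments.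
Unset Strict Implicit.

(** * Calculus on the line *)

Section calculus.
Context {R : realType}.
Implicit Types f g df : R -> R.

(** (G3) speaks only of values taken by a solution, so the monotonicity of gamma on an interval goes
    through the intermediate value theorem for q. That g'(a) < 0 rests on two exclusions: g'(a) > 0
    would make q'^2 negative at a value just below a, and g'(a) = 0 would make a a rest point, hence
    q constant. The rescaled equation is degenerate at the starting height W = 1, where the slope is
    0 and uniqueness for a first-order equation may fail; this is why W1 and W2 are compared through
    the inverse function of W1, away from 0. When a1 < a2, equality of the rescalings only says that
    gamma(a1 t) = gamma(a2 t) for 0 < t < 1; iterating the dilation by a1 / a2 and using
    monotonicity makes gamma constant. Integration then leaves s G' - 6 G = c s^2, and it is G''(0)
    = 0, a consequence of (G4), that kills c. *)

Lemma is_derive_continuous f df :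
  (forall x, is_derive x (1 : R) f (df x)) -> continuous f.
Proof.
by move=> h x; apply/differentiable_continuous/derivable1_diffP; case: (h x).
Qed.

Lemma is_derive_within f df (a b : R) :
  (forall x, a <= x <= b -> is_derive x (1 : R) f (df x)) ->
  {within `[a, b], continuous f}.
Proof.
move=> h; apply: derivable_within_continuous => x; rewrite in_itv/= => xab.
by case: (h x xab).
Qed.

Lemma mean_value f df (a b : R) : a <= b ->
  (forall x, a <= x <= b -> is_derive x (1 : R) f (df x)) ->
  exists2 c, a <= c <= b & f b - f a = df c * (b - a).
Proof.
move=> ab h; have [||c] := @MVT_segment R f df a b ab.
- by move=> x; rewrite in_itv/= => /andP[/ltW ax /ltW xb]; apply: h; rewrite ax.
- exact: is_derive_within h.
- by rewrite in_itv/=; exists c.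
Qed.

Lemma is_derive_nonincr f df (a b : R) : a <= b ->
  (forall x, a <= x <= b -> is_derive x (1 : R) f (df x)) ->
  (forall x, a <= x <= b -> df x <= 0) -> f b <= f a.
Proof.
move=> ab h df0; have [c cab E] := mean_value ab h.
by rewrite -subr_le0 E mulr_le0_ge0 ?df0 ?subr_ge0.
Qed.

Lemma is_derive_nondecr f df (a b : R) : a <= b ->
  (forall x, a <= x <= b -> is_derive x (1 : R) f (df x)) ->
  (forall x, a <= x <= b -> 0 <= df x) -> f a <= f b.
Proof.
move=> ab h df0; have [c cab E] := mean_value ab h.
by rewrite -subr_ge0 E mulr_ge0 ?df0 ?subr_ge0.
Qed.

Lemma is_derive_decr f df (a b : R) : a < b ->
  (forall x, a <= x <= b -> is_derive x (1 : R) f (df x)) ->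
  (forall x, a < x < b -> df x < 0) -> f b < f a.
Proof.
move=> ab h df0; have [||c] := @MVT R f df a b ab.
- by move=> x; rewrite in_itv/= => /andP[/ltW ax /ltW xb]; apply: h; rewrite ax.
- exact: is_derive_within h.
- rewrite in_itv/= => cab E.
  by rewrite -subr_lt0 E pmulr_llt0 ?subr_gt0 ?df0.
Qed.

Lemma is_derive_zero_const f df (a b : R) : a <= b ->
  (forall x, is_derive x (1 : R) f (df x)) ->
  (forall x, a < x -> x < b -> df x = 0) -> f b = f a.
Proof.
rewrite le_eqVlt => /predU1P[->//|ab] h df0.
have cf : {within `[a, b], continuous f} by exact: is_derive_within (fun x _ => h x).
have [c] := MVT ab (fun x _ => h x) cf.
rewrite in_itv/= => /andP[ac cb]; rewrite df0// mul0r => /eqP.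
by rewrite subr_eq0 => /eqP.
Qed.

Lemma is_derive_unique f (x a b : R) :
  is_derive x (1 : R) f a -> is_derive x (1 : R) f b -> a = b.
Proof. by move=> [_ <-] [_ <-]. Qed.

Lemma is_derive_chain f g (x a b : R) :
  is_derive (f x) (1 : R) g b -> is_derive x (1 : R) f a ->
  is_derive x (1 : R) (fun y => g (f y)) (b * a).
Proof. exact: is_derive1_comp. Qed.

Lemma is_derive_scale_arg f df (k : R) :
  (forall x, is_derive x (1 : R) f (df x)) ->
  forall x, is_derive x (1 : R) (fun y => f (k * y)) (df (k * x) * k).
Proof.
move=> h x; apply: (is_derive_chain (f := fun y => k * y) (h _)).
by apply: is_derive_eq; rewrite /GRing.scale/= mulr1.
Qed.

Lemma is_derive_affine_arg f df (k c : R) :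
  (forall x, is_derive x (1 : R) f (df x)) ->
  forall x, is_derive x (1 : R) (fun y => f (k * y + c)) (k * df (k * x + c)).
Proof.
move=> h x; rewrite mulrC; apply: (is_derive_chain (f := fun y => k * y + c) (h _)).
by apply: is_derive_eq; rewrite /GRing.scale/=; ring.
Qed.

Lemma continuous_affine_arg f (k c : R) : continuous f ->
  continuous (fun y => k * f (k * y + c)).
Proof.
move=> cf x; apply: cvgM; first exact: cvg_cst.
apply: (@continuous_comp _ _ _ (fun y : R => k * y + c) f x); last exact: cf.
by apply: cvgD; [apply: cvgM; [exact: cvg_cst|exact: cvg_id]|exact: cvg_cst].
Qed.

Lemma is_derive_expR_lin (k x : R) :
  is_derive x (1 : R) (fun y => expR (k * y)) (expR (k * x) * k).
Proof. exact: is_derive_scale_arg (fun x => is_derive_expR x) x. Qed.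

Lemma IVT_between f (a b v : R) : a <= b -> {within `[a, b], continuous f} ->
  (f a <= v <= f b) || (f b <= v <= f a) -> exists2 c, a <= c <= b & f c = v.
Proof.
move=> ab cf h; have [|c] := @IVT R f a b v ab cf; last first.
  by rewrite in_itv/=; exists c.
by rewrite ge_min le_max; case/orP: h => /andP[-> ->]; rewrite ?orbT.
Qed.

(** Gronwall's argument: [f ^+ 2] times [expR (- (2 * L) * y)] is nonincreasing to the right of
    [x0], and [f ^+ 2] times [expR (2 * L * y)] is nondecreasing to the left. It serves as the
    uniqueness theorem for differential equations. *)
Lemma linear_growth_zero f df (L x0 : R) :
  (forall x, is_derive x (1 : R) f (df x)) ->
  (forall x, `|df x| <= L * `|f x|) -> f x0 = 0 -> forall x, f x = 0.
Proof.
move=> h hL fx0 x.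
have bnd y : `|2 * (f y * df y)| <= 2 * L * f y ^+ 2.
  rewrite !normrM (ger0_norm (ler0n _ 2)) -mulrA ler_pM2l ?ltr0n//.
  rewrite -real_normK ?num_real// expr2.
  rewrite mulrA [leRHS]mulrC; apply: ler_wpM2l => //; exact: hL.
have dE (k y : R) : is_derive y (1 : R) (fun y => f y ^+ 2 * expR (k * y))
    ((2 * (f y * df y) + k * f y ^+ 2) * expR (k * y)).
  have := is_derive_expR_lin k y => he; have := h y => hy.
  by apply: is_derive_eq; rewrite /GRing.scale/=; ring.
suff : f x ^+ 2 <= 0 by rewrite real_exprn_even_le0 ?num_real//= => /eqP.
have E0 k : f x0 ^+ 2 * expR (k * x0) = 0 by rewrite fx0 expr0n mul0r.
have [xx0|x0x] := lerP x0 x.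
- have := @is_derive_nonincr (fun y => f y ^+ 2 * expR (- (2 * L) * y)) _ x0 x xx0
    (fun y _ => dE _ y).
  rewrite E0 pmulr_lle0 ?expR_gt0//; apply => y _.
  rewrite pmulr_lle0 ?expR_gt0//.
  have := bnd y; rewrite ler_norml => /andP[_]; lra.
- have := @is_derive_nondecr (fun y => f y ^+ 2 * expR (2 * L * y)) _ x x0
    (ltW x0x) (fun y _ => dE _ y).
  rewrite E0 pmulr_lle0 ?expR_gt0//; apply => y _.
  rewrite pmulr_lge0 ?expR_gt0//.
  have := bnd y; rewrite ler_norml => /andP[+ _]; lra.
Qed.

Lemma continuous_segment_bounded f (a b : R) : continuous f ->
  exists2 L : R, 0 <= L & forall x, a <= x <= b -> `|f x| <= L.
Proof.
move=> cf; have [ab|ba] := lerP a b; last first.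
  by exists 0 => // x /andP[ax xb]; move: (le_trans ax xb); rewrite leNgt ba.
have [|c cab hc] := @EVT_max R (fun x => `|f x|) a b ab.
  apply: continuous_subspaceT => x; apply: (continuous_comp (cf x)).
  exact: norm_continuous.
exists `|f c|; first exact: normr_ge0.
by move=> x xab; apply: hc; rewrite in_itv.
Qed.

(** The mean value theorem is applied twice, to [f] and then to [df]; [L] bounds [ddf] on the whole
    segment, and the factor 1/2 of Taylor's formula is given up. *)
Lemma taylor2_bound f df (ddf : R -> R) (B : R) :
  (forall x, is_derive x (1 : R) f (df x)) ->
  (forall x, is_derive x (1 : R) df (ddf x)) -> continuous ddf ->
  exists2 L : R, 0 <= L & forall x y, `|x| <= B -> `|y| <= B ->
    `|f y - f x - df x * (y - x)| <= L * (y - x) ^+ 2.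
Proof.
move=> h1 h2 c2; have [L L0 hL] := continuous_segment_bounded (- B) B c2.
exists L => // x y xB yB.
have btw z : (x <= z <= y) || (y <= z <= x) ->
    (`|z - x| <= `|y - x|) /\ (- B <= z <= B).
  have /andP[? ?] : - B <= x <= B by rewrite -ler_norml.
  have /andP[? ?] : - B <= y <= B by rewrite -ler_norml.
  case/orP => /andP[? ?].
    by split; [rewrite !ger0_norm; lra|apply/andP; split; lra].
  by split; [rewrite !ler0_norm; lra|apply/andP; split; lra].
have mv f0 df0 a b : (forall x, is_derive x (1 : R) f0 (df0 x)) ->
    exists2 c, (a <= c <= b) || (b <= c <= a) & f0 b - f0 a = df0 c * (b - a).
  move=> h; have [ab|/ltW ba] := lerP a b.
    by have [c cc E] := mean_value ab (fun x _ => h x); exists c; first by rewrite cc.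
  have [c cc E] := mean_value ba (fun x _ => h x); exists c; first by rewrite cc orbT.
  by rewrite -opprB E; ring.
have [c cc ->] := mv _ _ x y h1; rewrite -mulrBl normrM.
have [cx _] := btw _ cc.
have [d dd ->] := mv _ _ x c h2.
have /btw[_ dB] : (x <= d <= y) || (y <= d <= x).
  move: cc dd => /orP[]/andP[? ?] /orP[]/andP[? ?]; apply/orP;
    first [left; apply/andP; split; lra|right; apply/andP; split; lra].
rewrite normrM -mulrA -[(y - x) ^+ 2]real_normK ?num_real// expr2.
by apply: ler_pM; rewrite ?mulr_ge0 ?ler_wpM2r ?(hL _ dB).
Qed.

Lemma nonvanishing_same_sign f : continuous f ->
  (forall x, f x != 0) -> forall a b, 0 <= f a * f b.
Proof.
move=> cf f0; suff cross a b : a <= b -> 0 <= f a * f b.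
  move=> a b; have [/cross//|/ltW/cross] := lerP a b; by rewrite mulrC.
move=> ab; rewrite leNgt; apply/negP => h.
have cfab : {within `[a, b], continuous f} by exact: continuous_subspaceT.
have [|c _ fc] := IVT_between (v := 0) ab cfab; last first.
  by have := f0 c; rewrite fc eqxx.
have [fa|fa] := lerP (f a) 0; apply/orP; [left|right]; apply/andP; split=> //.
- by rewrite leNgt; apply/negP => fb; nra.
- by rewrite leNgt; apply/negP => fb; nra.
- exact: ltW.
Qed.

End calculus.

(** * Comparison of decreasing functions through their slopes at equal height *)

Section comparison.
Context {R : realType}.
Implicit Types f g df : R -> R.

(* With T the inverse function of W1, the map z |-> T (W2 z) - z is
   nonincreasing and vanishes at 0. *)
Lemma autonomous_comparison (W1 W2 dW1 dW2 : R -> R) (a : R) :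
  (forall y, is_derive y (1 : R) W1 (dW1 y)) ->
  (forall y, is_derive y (1 : R) W2 (dW2 y)) ->
  W1 0 = a -> W2 0 = a ->
  (forall y : R, 0 < y -> dW1 y < 0) ->
  (forall y : R, 0 < y -> 0 < W1 y < a) -> (forall y : R, 0 < y -> 0 < W2 y < a) ->
  (forall t : R, 0 < t < a -> exists2 y : R, 0 < y & W1 y = t) ->
  (forall y z : R, 0 < y -> 0 < z -> W1 y = W2 z -> dW1 y <= dW2 z) ->
  forall y, 0 <= y -> W1 y <= W2 y.
Proof.
move=> h1 h2 W10 W20 dW1_lt0 W1_in W2_in W1_surj dW_le.
have W1_decr (x y : R) : 0 <= x -> x < y -> W1 y < W1 x.
  move=> x0 xy; apply: (is_derive_decr xy (fun x _ => h1 x)) => z /andP[xz _].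
  exact/dW1_lt0/(le_lt_trans x0).
(* The default value 0 is never met: [T] is only used at heights strictly between 0 and [a]. *)
pose T (t : R) : R := xget 0 [set y | 0 < y /\ W1 y = t].
have TP (t : R) : 0 < t < a -> 0 < T t /\ W1 (T t) = t.
  move=> /W1_surj[y y0 yt]; rewrite /T; case: xgetP => [z _ //|].
  by move=> /(_ y) []; split.
have TK (y : R) : 0 < y -> T (W1 y) = y.
  move=> y0; have [Ty0 E] := TP _ (W1_in _ y0).
  apply/eqP; rewrite eq_le; apply/andP; split; rewrite leNgt; apply/negP => lt.
    by have := W1_decr _ _ (ltW y0) lt; rewrite E ltxx.
  by have := W1_decr _ _ (ltW Ty0) lt; rewrite E ltxx.
have dT (y : R) : 0 < y -> is_derive (W1 y) (1 : R) T (dW1 y)^-1.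
  move=> y0; apply: (@is_derive_inverse R W1 T); last by rewrite lt_eqF ?dW1_lt0.
  - near=> z; apply: TK; near: z; exact: lt_nbhsr.
  - near=> z; exact: (is_derive_continuous h1).
have dD (z : R) : 0 < z ->
    is_derive z (1 : R) (fun z : R => T (W2 z) - z) ((dW1 (T (W2 z)))^-1 * dW2 z - 1).
  move=> z0; have [Tz0 Ez] := TP _ (W2_in _ z0).
  have := dT _ Tz0; rewrite Ez => dTz.
  have := is_derive_chain dTz (h2 z) => ?.
  exact: is_deriveB.
have dD_le0 (z : R) : 0 < z -> (dW1 (T (W2 z)))^-1 * dW2 z - 1 <= 0.
  move=> z0; have [Tz0 Ez] := TP _ (W2_in _ z0).
  have lt0 := dW1_lt0 _ Tz0; have := dW_le _ _ Tz0 z0 Ez.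
  by rewrite subr_le0 mulrC ler_ndivrMr// mul1r.
move=> y; rewrite le_eqVlt => /predU1P[<-|y0]; first by rewrite W10 W20.
suff : T (W2 y) <= y.
  have [Ty0 Ey] := TP _ (W2_in _ y0); rewrite -{2}Ey le_eqVlt => /predU1P[->//|].
  by move=> /(W1_decr _ _ (ltW Ty0))/ltW.
(* [T] is known to be differentiable only below height [a], so the monotone map is not evaluated at
   0. It is evaluated at a small [z] with [W2 z > W1 e], where [T (W2 z) <= e]. *)
apply/ler_addgt0Pr => e e0.
have : \forall z \near (0 : R), W1 e < W2 z.
  have c2 : continuous W2 by exact: (is_derive_continuous h2).
  have /cvgr_gt := c2 (0 : R).
  by apply; rewrite W20; case/andP: (W1_in _ e0).
move/nbhs_ballP => -[d /= d0 hd].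
pose z := Num.min (d / 2) y.
have z0 : 0 < z by rewrite lt_min y0 divr_gt0.
have zy : z <= y by rewrite ge_min lexx orbT.
have /hd We : ball (0 : R) d z.
  rewrite /ball/= sub0r normrN gtr0_norm//.
  by rewrite (@le_lt_trans _ _ (d / 2)) ?ge_min ?lexx// gtr_pMr// invf_lt1 ?ltr1n.
have Tz : T (W2 z) <= e.
  have [Tz0 Ez] := TP _ (W2_in _ z0).
  rewrite leNgt; apply/negP => /(W1_decr _ _ (ltW e0)).
  by rewrite Ez ltNge ltW.
have : T (W2 y) - y <= T (W2 z) - z.
  apply: (is_derive_nonincr (f := fun z => T (W2 z) - z) zy) => x /andP[zx _].
    exact/dD/(lt_le_trans z0).
  exact/dD_le0/(lt_le_trans z0).
move: Tz z0; lra.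
Unshelve. all: by end_near. Qed.

End comparison.

(** * Positive even solutions *)

Section profiles.
Context {R : realType}.
Variables G G1 G2 : R -> R.

(* A positive even solution of -q'' + G'(q) + w q = 0, with q' = V, at zero
   Hamiltonian energy. *)
Record profile (w : R) (q V : R -> R) : Prop := Profile {
  profile_q : forall x, is_derive x (1 : R) q (V x);
  profile_V : forall x, is_derive x (1 : R) V (G1 (q x) + w * q x);
  profile_even : forall x, q (- x) = q x;
  profile_gt0 : forall x, 0 < q x;
  profile_small : forall e : R, 0 < e -> exists x, q x < e;
  profile_bounded : exists B : R, forall x, q x <= B;
  profile_energy : forall x, V x ^+ 2 = 2 * G (q x) + w * q x ^+ 2;
  profile_G3 : forall x,
    0 <= 12 * G (q x) - 7 * q x * G1 (q x) + q x ^+ 2 * G2 (q x) }.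

Hypothesis dG : forall s, is_derive s (1 : R) G (G1 s).
Hypothesis dG1 : forall s, is_derive s (1 : R) G1 (G2 s).
Hypothesis cG2 : continuous G2.

Definition quot2 (s : R) : R := G s / s ^+ 2.

(* quot2' = s ^ 3 * gamma, and (G3) says that gamma is nondecreasing. *)
Definition gamma (s : R) : R := (s * G1 s - 2 * G s) / s ^+ 6.

Lemma is_derive_quot2 (s : R) : 0 < s ->
  is_derive s (1 : R) quot2 (gamma s * s ^+ 3).
Proof.
move=> s0; have s_neq0 : s != 0 by rewrite gt_eqF.
have dV : is_derive s (1 : R) (fun y : R => (y ^+ 2)^-1)
    (- (s ^+ 2) ^- 2 *: (2 * s)).
  apply: is_deriveV; first by rewrite expf_neq0.
  by apply: is_derive_eq; rewrite /GRing.scale/=; ring.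
have := dG s => dGs; apply: is_derive_eq.
by rewrite /gamma /GRing.scale/=; field.
Qed.

Lemma is_derive_gamma (s : R) : 0 < s ->
  is_derive s (1 : R) gamma
    ((12 * G s - 7 * s * G1 s + s ^+ 2 * G2 s) / s ^+ 7).
Proof.
move=> s0; have s_neq0 : s != 0 by rewrite gt_eqF.
have dV : is_derive s (1 : R) (fun y : R => (y ^+ 6)^-1)
    (- (s ^+ 6) ^- 2 *: (6 * s ^+ 5)).
  apply: is_deriveV; first by rewrite expf_neq0.
  by apply: is_derive_eq; rewrite /GRing.scale/=; ring.
have := dG s => dGs; have := dG1 s => dG1s; apply: is_derive_eq.
by rewrite /GRing.scale/=; field.
Qed.

(** * Shape of a single profile *)

Section one_profile.
Variables (w : R) (q V : R -> R).
Hypothesis qV : profile w q V.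
Let a := q 0.

Let a_gt0 : 0 < a. Proof. exact: profile_gt0 qV 0. Qed.

Lemma profile_continuous : continuous q.
Proof. exact: (is_derive_continuous (profile_q qV)). Qed.

(** Intermediate values between [q x] and the small values of [q]. This spreads [profile_G3] and the
    sign of [V ^+ 2] from points of the line to whole intervals of heights. *)
Lemma profile_range_down (x s : R) : 0 < s <= q x -> exists y, q y = s.
Proof.
move=> /andP[s0 sqx]; have [y qys] := profile_small qV s0.
have cq z t : {within `[z, t], continuous q}.
  exact: is_derive_within (fun x _ => profile_q qV x).
have [xy|/ltW yx] := lerP x y.
  have [|c _ <-] := IVT_between (v := s) xy (cq _ _); last by exists c.
  by rewrite sqx (ltW qys) orbT.
have [|c _ <-] := IVT_between (v := s) yx (cq _ _); last by exists c.
by rewrite sqx (ltW qys).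
Qed.

Lemma profile_V_odd (x : R) : V (- x) = - V x.
Proof.
have d1 : is_derive x (1 : R) (fun y => q (- y)) (V (- x) * - 1).
  apply: (is_derive_chain (f := -%R)); exact: profile_q qV (- x).
have E : (fun y => q (- y)) = q by apply/funext => y; exact: profile_even qV y.
rewrite E in d1; have := is_derive_unique d1 (profile_q qV x); lra.
Qed.

Lemma profile_V0 : V 0 = 0.
Proof. have := profile_V_odd 0; rewrite oppr0; lra. Qed.

(** At 0 the slope vanishes by evenness, so the zero energy identity ties the frequency to the
    height: from here on only [a] matters. *)
Lemma profile_omega : w = - 2 * quot2 a.
Proof.
have := profile_energy qV 0; rewrite profile_V0 expr0n/= /quot2 -/a => E.
have a_neq0 : a != 0 by rewrite gt_eqF.
apply: (mulIf (expf_neq0 2 a_neq0)); rewrite -mulrA divfK ?expf_neq0//; lra.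
Qed.

Lemma profile_energyE (x : R) :
  V x ^+ 2 = 2 * q x ^+ 2 * (quot2 (q x) - quot2 a).
Proof.
rewrite (profile_energy qV) profile_omega /quot2.
have a_neq0 : a != 0 by rewrite gt_eqF.
have q_neq0 : q x != 0 by rewrite gt_eqF// (profile_gt0 qV).
by field; rewrite a_neq0.
Qed.

Lemma profile_quot2_ge (x : R) : quot2 a <= quot2 (q x).
Proof.
have := sqr_ge0 (V x); rewrite profile_energyE pmulr_rge0 ?subr_ge0//.
by rewrite mulr_gt0 ?exprn_gt0 ?(profile_gt0 qV).
Qed.

Lemma profile_gamma_nondecr (x s t : R) : 0 < s -> s <= t -> t <= q x ->
  gamma s <= gamma t.
Proof.
move=> s0 st tq.
apply: (is_derive_nondecr st (fun y yst => is_derive_gamma _)) => y /andP[sy yt].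
  exact: lt_le_trans sy.
have y0 := lt_le_trans s0 sy.
apply: divr_ge0; last by rewrite exprn_ge0// ltW.
have [|z <-] := @profile_range_down x y; last exact: profile_G3 qV z.
by rewrite y0 (le_trans yt).
Qed.

Let gamma_near : gamma a != 0 ->
  exists2 d : R, 0 < d & forall s, `|s - a| < d -> 0 < s /\ 0 < gamma s * gamma a.
Proof.
move=> ga0.
have cg : {for a, continuous (fun s => gamma s * gamma a)}.
  apply: (@continuousM _ _ gamma (cst (gamma a))); last exact: cst_continuous.
  apply/differentiable_continuous/derivable1_diffP.
  by case: (is_derive_gamma a_gt0).
have /cvgr_gt/(_ 0) := cg.
rewrite -expr2 exprn_even_gt0//= => /(_ ga0)/nbhs_ballP[d /= d0 hd].
exists (Num.min d a); first by rewrite lt_min d0.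
move=> s; rewrite lt_min => /andP[sd sa]; split.
  by move: sa; rewrite ltr_norml => /andP[]; lra.
by apply: hd; rewrite /ball/= distrC.
Qed.

Let quot2_mv (s t : R) : 0 < s -> s <= t ->
  exists2 c, s <= c <= t & quot2 t - quot2 s = gamma c * c ^+ 3 * (t - s).
Proof.
move=> s0 st; apply: (mean_value (df := fun c => gamma c * c ^+ 3)) => //.
by move=> c /andP[sc _]; apply: is_derive_quot2; exact: lt_le_trans sc.
Qed.

(** If [gamma a = 0], then [a] is a rest point of the equation and Gronwall forces [q] to stay at
    [a], against [profile_small]. If [gamma a > 0], then [quot2] increases up to [a], and [q] takes
    a value slightly below [a] at which [V ^+ 2] would be negative. *)
Lemma profile_gamma_lt0 : gamma a < 0.
Proof.
rewrite ltNge; apply/negP; rewrite le_eqVlt => /predU1P[ga0|ga0].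
  have a_neq0 : a != 0 by rewrite gt_eqF.
  have ga : a * G1 a = 2 * G a.
    move/esym/eqP : ga0; rewrite mulf_eq0 invr_eq0 expf_eq0/= (negbTE a_neq0) orbF.
    by rewrite subr_eq0 => /eqP.
  have [B hB] := profile_bounded qV.
  have [L L0 hL] := taylor2_bound B dG dG1 cG2.
  have qB x : `|q x| <= B by rewrite ger0_norm ?hB// ltW// (profile_gt0 qV).
  have qa : forall x, q x - a = 0.
    (* [V ^+ 2] is at most [2 * L + |w|] times [(q x - a) ^+ 2]; adding 1 makes the square of the
       constant exceed this factor, which avoids a square root. *)
    apply: (@linear_growth_zero _ _ V (2 * L + `|w| + 1) 0); last by rewrite /a subrr.
      move=> x; have := profile_q qV x => ?; apply: is_derive_eq.
      by rewrite subr0.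
    move=> x; have := hL _ _ (qB 0) (qB x); rewrite -/a => /(le_trans (ler_norm _)).
    (* Here [a] is a double zero of [2 * G s + w * s ^+ 2], so only the second-order Taylor
       remainder survives. *)
    have E2 : V x ^+ 2 = 2 * (G (q x) - G a - G1 a * (q x - a)) + w * (q x - a) ^+ 2.
      rewrite (profile_energy qV) profile_omega /quot2.
      have -> : G1 a = 2 * G a / a by rewrite -ga; field.
      by field.
    have := ler_norm w; have := sqr_ge0 (q x - a); have := normr_ge0 w.
    set W := `|w|; set z := (q x - a) ^+ 2 => W0 z0 wW hG.
    have V2 : V x ^+ 2 <= (2 * L + W + 1) ^+ 2 * z.
      rewrite E2 -/z; have : w * z <= W * z by rewrite ler_wpM2r.
      have : (2 * L + W) * z <= (2 * L + W + 1) ^+ 2 * z.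
        by rewrite ler_wpM2r//; nra.
      lra.
    rewrite -(@ler_pXn2r _ 2) ?nnegrE ?mulr_ge0//; first last.
      by rewrite !addr_ge0// mulr_ge0.
    by rewrite exprMn !real_normK ?num_real// subr0.
  have [x] := profile_small qV a_gt0.
  by have := qa x; lra.
have [d d0 hd] := gamma_near (lt0r_neq0 ga0).
have da : 0 < a - d / 2.
  by have [|//] := hd (a - d / 2); rewrite addrC addKr normrN gtr0_norm; lra.
have [|c /andP[c1 c2] E] := quot2_mv (s := a - d / 2) (t := a) da; first lra.
have [|x qx] := @profile_range_down 0 (a - d / 2).
  by rewrite da -/a; lra.
have := profile_quot2_ge x; rewrite qx -subr_le0 E leNgt.
have [c0] : 0 < c /\ 0 < gamma c * gamma a by apply: hd; rewrite ltr_norml; apply/andP; split; lra.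
rewrite pmulr_lgt0// => gc /negP; apply.
by rewrite pmulr_rgt0; [lra|rewrite mulr_gt0 ?exprn_gt0].
Qed.

(** Otherwise [q] would take a value just above [a], where [quot2] is already below [quot2 a] since
    [gamma] is negative near [a]; this contradicts [profile_quot2_ge]. *)
Lemma profile_le_top (x : R) : q x <= a.
Proof.
rewrite leNgt; apply/negP => aq; have ga0 := profile_gamma_lt0.
have [d d0 hd] := gamma_near (ltr0_neq0 ga0).
pose s := Num.min (q x) (a + d / 2).
have as_ : a < s by rewrite lt_min aq; lra.
have sq : s <= q x by rewrite ge_min lexx.
have sd : s <= a + d / 2 by rewrite ge_min lexx orbT.
have [c /andP[c1 c2] E] := quot2_mv a_gt0 (ltW as_).
have [|y qy] := @profile_range_down x s; first by rewrite sq (lt_trans a_gt0).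
have := profile_quot2_ge y; rewrite qy -subr_ge0 E leNgt.
have [c0] : 0 < c /\ 0 < gamma c * gamma a by apply: hd; rewrite ltr_norml; apply/andP; split; lra.
rewrite nmulr_lgt0// => gc /negP; apply.
by rewrite pmulr_llt0 ?subr_gt0// pmulr_llt0// exprn_gt0.
Qed.

Lemma profile_gamma_le (s t : R) : 0 < s -> s <= t -> t <= a ->
  gamma s <= gamma t.
Proof. exact: (@profile_gamma_nondecr 0 s t). Qed.

Lemma profile_quot2_decr (s t : R) : 0 < s -> s < t -> t <= a ->
  quot2 t < quot2 s.
Proof.
move=> s0 st ta; have [c /andP[sc ct] E] := quot2_mv s0 (ltW st).
rewrite -subr_lt0 E; have c0 := lt_le_trans s0 sc.
have : gamma c <= gamma a by apply: profile_gamma_le => //; exact: le_trans ta.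
move=> /le_lt_trans/(_ profile_gamma_lt0) gc.
by rewrite pmulr_llt0 ?subr_gt0// pmulr_llt0// exprn_gt0.
Qed.

(** The energy identity gives [quot2 (q x) = quot2 a], and [quot2] is injective on ]0, a]. *)
Lemma profile_critical (x : R) : V x = 0 -> q x = a.
Proof.
move=> Vx; have q0 := profile_gt0 qV x.
have := profile_energyE x; rewrite Vx expr0n/= => /esym/eqP.
rewrite mulf_eq0 mulf_eq0 pnatr_eq0 expf_eq0/= (gt_eqF q0)/= subr_eq0 => /eqP E.
apply/eqP; rewrite eq_le profile_le_top/= leNgt; apply/negP => /(profile_quot2_decr q0).
by move=> /(_ (lexx _)); rewrite E ltxx.
Qed.

Let top_accel : G1 a + w * a < 0.
Proof.
have a_neq0 : a != 0 by rewrite gt_eqF.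
have -> : G1 a + w * a = gamma a * a ^+ 5.
  by rewrite profile_omega /gamma /quot2; field.
by rewrite pmulr_llt0 ?exprn_gt0 ?profile_gamma_lt0.
Qed.

(** A second critical point has height [a], and so has the minimum of [q] between it and 0, whether
    at an end or inside. Then [q] is constantly [a] on [[0, x]], which [top_accel] forbids. *)
Let V_neq0 (x : R) : 0 < x -> V x != 0.
Proof.
move=> x0; apply/negP => /eqP Vx; have qx := profile_critical Vx.
have cq : {within `[0, x], continuous q}.
  exact: is_derive_within (fun x _ => profile_q qV x).
have [c] := EVT_min (ltW x0) cq; rewrite in_itv/= => /andP[c0 cx] hc.
have Vc : q c = a.
  have [->//|c_neq0] := eqVneq c 0; have [->//|c_neqx] := eqVneq c x.
  have c_in : c \in `]0, x[%R by rewrite in_itv/= !lt_neqAle c0 cx c_neqx eq_sym c_neq0.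
  have dc : is_derive c (1 : R) q 0.
    apply: (derive1_at_min (ltW x0) _ c_in); first by move=> t _; case: (profile_q qV t).
    by move=> t t_in; apply: hc; exact: subset_itv_oo_cc.
  exact: profile_critical (is_derive_unique (profile_q qV c) dc).
have qE t : 0 <= t <= x -> q t = a.
  by move=> h; apply/eqP; rewrite eq_le profile_le_top -Vc hc// in_itv.
have V0 t : 0 < t < x -> V t = 0.
  move=> t_in; apply: is_derive_unique (profile_q qV t) _.
  apply: (derive1_at_max (ltW x0) (c := t)); rewrite ?in_itv//.
    by move=> s _; case: (profile_q qV s).
  move=> s; rewrite in_itv/= => /andP[/ltW s0 /ltW sx].
  by rewrite qE ?s0//; case/andP: t_in => /ltW t0 /ltW tx; rewrite qE ?t0.
(* Two interior points, since [V0] is stated on the open interval. *)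
have le42 : x / 4 <= x / 2 by lra.
have [c' /andP[c1 c2]] := mean_value le42 (fun x _ => profile_V qV x).
rewrite !V0 ?subrr; [|apply/andP; split; lra|apply/andP; split; lra].
rewrite qE; last by apply/andP; split; lra.
by move/esym/eqP; rewrite mulf_eq0 (lt_eqF top_accel)/= => /eqP; lra.
Qed.

Lemma profile_V_lt0 (x : R) : 0 < x -> V x < 0.
Proof.
move=> x0; rewrite ltNge le_eqVlt eq_sym (negbTE (V_neq0 x0))/=; apply/negP => Vx.
have [||c] := @MVT R q V 0 x x0.
- by move=> y _; exact: profile_q qV y.
- exact: is_derive_within (fun x _ => profile_q qV x).
rewrite in_itv/= => /andP[c0 cx] E.
have Vc : V c <= 0.
  have : V c * (x - 0) <= 0 by rewrite -E subr_le0 profile_le_top.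
  by rewrite pmulr_lle0 ?subr_gt0.
have [||e /andP[ce _] Ve] := IVT_between (f := V) (v := 0) (ltW cx).
- exact: is_derive_within (fun x _ => profile_V qV x).
- by rewrite Vc ltW.
by have := V_neq0 (lt_le_trans c0 ce); rewrite Ve eqxx.
Qed.

Lemma profile_lt_top (x : R) : 0 < x -> q x < a.
Proof.
move=> x0; apply: (is_derive_decr x0 (fun x _ => profile_q qV x)).
by move=> y /andP[y0 _]; exact: profile_V_lt0.
Qed.

Lemma profile_onto (s : R) : 0 < s < a -> exists2 x : R, 0 < x & q x = s.
Proof.
move=> /andP[s0 sa]; have [|x qx] := @profile_range_down 0 s; first by rewrite s0 ltW.
exists `|x|; last by case: (ger0P x); rewrite ?(profile_even qV).
by rewrite normr_gt0; apply: contraTneq sa => x0; rewrite -qx x0 ltxx.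
Qed.

End one_profile.
Let gap (a t : R) : R := (quot2 (a * t) - quot2 a) / a ^+ 4.

(** The division by [a ^+ 4] cancels every power of [a] produced by the chain rule, so that gaps of
    different heights are compared through [gamma] alone. *)
Let is_derive_gap (a t : R) : 0 < a -> 0 < t ->
  is_derive t (1 : R) (gap a) (gamma (a * t) * t ^+ 3).
Proof.
move=> a0 t0; have a_neq0 : a != 0 by rewrite gt_eqF.
have dat : is_derive t (1 : R) (fun t => quot2 (a * t))
    (gamma (a * t) * (a * t) ^+ 3 * a).
  apply: (is_derive_chain (f := fun t => a * t)).
    by apply: is_derive_quot2; rewrite mulr_gt0.
  by apply: is_derive_eq; rewrite /GRing.scale/= mulr1.
by apply: is_derive_eq; rewrite /GRing.scale/=; field.
Qed.

(** * Comparison of two rescaled profiles of equal mass *)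

Section two_profiles.
Variables (w1 w2 : R) (q1 q2 V1 V2 : R -> R).
Hypothesis (pq1 : profile w1 q1 V1) (pq2 : profile w2 q2 V2).
Let a1 := q1 0.
Let a2 := q2 0.
Hypothesis a12 : a1 <= a2.

Let a1_gt0 : 0 < a1. Proof. exact: profile_gt0 pq1 0. Qed.
Let a2_gt0 : 0 < a2. Proof. exact: profile_gt0 pq2 0. Qed.

Let gap_diff t := gap a1 t - gap a2 t.

Let is_derive_gap_diff (t : R) : 0 < t -> is_derive t (1 : R) gap_diff
  ((gamma (a1 * t) - gamma (a2 * t)) * t ^+ 3).
Proof.
move=> t0; have := is_derive_gap a1_gt0 t0; have := is_derive_gap a2_gt0 t0 => ? ?.
by apply: is_derive_eq; ring.
Qed.

(** Both gaps vanish at 1, and their difference is nonincreasing because [gamma] is nondecreasing up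
    to the larger height [a2]. *)
Let gap_diff_ge0 (t : R) : 0 < t -> t <= 1 -> 0 <= gap_diff t.
Proof.
move=> t0 t1.
have <- : gap_diff 1 = 0 by rewrite /gap_diff /gap !mulr1 !subrr !mul0r subr0.
apply: (is_derive_nonincr t1
  (df := fun t => (gamma (a1 * t) - gamma (a2 * t)) * t ^+ 3)).
  by move=> s /andP[ts _]; apply: is_derive_gap_diff; exact: lt_le_trans ts.
move=> s /andP[ts s1]; have s0 := lt_le_trans t0 ts.
rewrite pmulr_lle0 ?exprn_gt0// subr_le0.
apply: (profile_gamma_le pq2); first by rewrite mulr_gt0.
  by rewrite ler_wpM2r// ltW.
by rewrite ger_pMr.
Qed.

(* The mass-critical rescaling of a profile to unit height. *)
Let rescale (q : R -> R) (y : R) : R := q ((q 0) ^- 2 * y) / q 0.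
Let drescale (q V : R -> R) (y : R) : R := V ((q 0) ^- 2 * y) / (q 0) ^+ 3.

Section rescaled.
Variables (w : R) (q V : R -> R).
Hypothesis pq : profile w q V.
Let a := q 0.
Let a_gt0 : 0 < a. Proof. exact: profile_gt0 pq 0. Qed.
Let k_gt0 : 0 < a ^- 2. Proof. by rewrite invr_gt0 exprn_gt0. Qed.

Lemma is_derive_rescale (y : R) : is_derive y (1 : R) (rescale q) (drescale q V y).
Proof.
have := is_derive_scale_arg (a ^- 2) (profile_q pq) y => ?.
apply: is_derive_eq; rewrite /GRing.scale/= /drescale -/a.
by have a_neq0 := lt0r_neq0 a_gt0; field.
Qed.

Lemma rescale0 : rescale q 0 = 1.
Proof. by rewrite /rescale mulr0 divff// lt0r_neq0. Qed.

Lemma rescale_in (y : R) : 0 < y -> 0 < rescale q y < 1.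
Proof.
move=> y0; rewrite divr_gt0 ?(profile_gt0 pq)//= ltr_pdivrMr// mul1r.
by apply: (profile_lt_top pq); rewrite mulr_gt0.
Qed.

Lemma drescale_lt0 (y : R) : 0 < y -> drescale q V y < 0.
Proof.
move=> y0; rewrite pmulr_llt0 ?invr_gt0 ?exprn_gt0//.
by apply: (profile_V_lt0 pq); rewrite mulr_gt0.
Qed.

Lemma rescale_onto (t : R) : 0 < t < 1 -> exists2 y : R, 0 < y & rescale q y = t.
Proof.
move=> /andP[t0 t1]; have [|x x0 qx] := @profile_onto _ _ _ pq (a * t).
  by rewrite mulr_gt0//= gtr_pMr.
exists (a ^+ 2 * x); first by rewrite mulr_gt0 ?exprn_gt0.
rewrite /rescale mulKf ?expf_neq0 ?lt0r_neq0// qx.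
by rewrite mulrC mulKf// lt0r_neq0.
Qed.

Lemma drescale_sqr (y : R) :
  drescale q V y ^+ 2 = 2 * rescale q y ^+ 2 * gap a (rescale q y).
Proof.
rewrite /drescale /gap /rescale -/a exprMn (profile_energyE pq) -/a.
have a_neq0 := lt0r_neq0 a_gt0.
by rewrite mulrC [a * _]mulrC divfK//; field.
Qed.

End rescaled.

(** At equal heights the squared slope of the first function is the larger one by [gap_diff_ge0],
    and both slopes are negative: the first function descends faster. *)
Lemma profile_compare (y : R) : 0 <= y -> rescale q1 y <= rescale q2 y.
Proof.
apply: (autonomous_comparison (is_derive_rescale pq1) (is_derive_rescale pq2)
  (rescale0 pq1) (rescale0 pq2) (drescale_lt0 pq1) (rescale_in pq1) (rescale_in pq2) (rescale_onto pq1)) => {}y z.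
move=> y0 z0 E; have := drescale_lt0 pq1 y0; have := drescale_lt0 pq2 z0 => l2 l1.
have : drescale q2 V2 z ^+ 2 <= drescale q1 V1 y ^+ 2.
  have /andP[t0 t1] := rescale_in pq2 z0.
  rewrite (drescale_sqr pq1) (drescale_sqr pq2) E; apply: ler_wpM2l.
    by apply: mulr_ge0 => //; exact: sqr_ge0.
  by rewrite -subr_ge0; apply: gap_diff_ge0 => //; exact: ltW.
by move=> h; rewrite leNgt; apply/negP => lt; nra.
Qed.

Variables (M1 M2 : R -> R) (l : R).
Hypothesis dM1 : forall x, is_derive x (1 : R) M1 (q1 x ^+ 2).
Hypothesis dM2 : forall x, is_derive x (1 : R) M2 (q2 x ^+ 2).
Hypothesis M10 : M1 0 = 0.
Hypothesis M20 : M2 0 = 0.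
Hypothesis M1l : M1 x @[x --> +oo] --> l.
Hypothesis M2l : M2 x @[x --> +oo] --> l.

Lemma rescale_eq (y : R) : 0 < y -> rescale q1 y = rescale q2 y.
Proof.
move=> y0.
(* Since the rescaling preserves mass, [N y] is the integral of the difference of the squared
   rescalings over [[0, y]]. It is nondecreasing from 0 and tends to [l - l = 0], hence vanishes. *)
pose N y := M2 (a2 ^- 2 * y) - M1 (a1 ^- 2 * y).
have dN z : is_derive z (1 : R) N (rescale q2 z ^+ 2 - rescale q1 z ^+ 2).
  have := is_derive_scale_arg (a2 ^- 2) dM2 z.
  have := is_derive_scale_arg (a1 ^- 2) dM1 z => ? ?.
  apply: is_derive_eq; rewrite /rescale -/a1 -/a2.
  by have h1 := lt0r_neq0 a1_gt0; have h2 := lt0r_neq0 a2_gt0; field; rewrite h1.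
have N0 : N 0 = 0 by rewrite /N !mulr0 M10 M20 subr0.
have dN_ge0 z : 0 <= z -> 0 <= rescale q2 z ^+ 2 - rescale q1 z ^+ 2.
  move=> z0; rewrite subr_ge0 ler_sqr ?nnegrE ?profile_compare//.
    by rewrite divr_ge0 // ltW// (profile_gt0 pq1).
  by rewrite divr_ge0 // ltW// (profile_gt0 pq2).
have N_nondecr x z : 0 <= x -> x <= z -> N x <= N z.
  move=> x0 xz; apply: (is_derive_nondecr xz (fun y _ => dN y)) => t /andP[xt _].
  exact/dN_ge0/(le_trans x0).
have N_le0 z : 0 <= z -> N z <= 0.
  move=> z0; rewrite leNgt; apply/negP => Nz.
  have far (M : R -> R) (k : R) : 0 < k -> M x @[x --> +oo] --> l ->
      \forall y \near +oo, `|l - M (k * y)| < N z / 2.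
    move=> k0 /cvgrPdist_lt/(_ (N z / 2)) []; first by rewrite divr_gt0.
    move=> A [Ar hA]; exists (A / k); split; first exact: num_real.
    by move=> x Ax; apply: hA; rewrite mulrC -ltr_pdivrMr.
  have := far M1 (a1 ^- 2); rewrite invr_gt0 exprn_gt0// => /(_ isT M1l) far1.
  have := far M2 (a2 ^- 2); rewrite invr_gt0 exprn_gt0// => /(_ isT M2l) far2.
  move: far1 far2 => [A1 [_ h1]] [A2 [_ h2]].
  pose y' := Num.max z (Num.max A1 A2) + 1.
  have zy' : z <= y' by rewrite (@le_trans _ _ (Num.max z (Num.max A1 A2)))// ?le_max ?lexx// lerDl.
  have /h1 : A1 < y' by rewrite (@le_lt_trans _ _ (Num.max z (Num.max A1 A2)))// ?le_max ?lexx ?orbT// ltrDl.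
  have /h2 : A2 < y' by rewrite (@le_lt_trans _ _ (Num.max z (Num.max A1 A2)))// ?le_max ?lexx ?orbT// ltrDl.
  rewrite !ltr_norml => /andP[? ?] /andP[? ?].
  have := N_nondecr _ _ z0 zy'; rewrite {2}/N; lra.
have NE z : 0 <= z -> N z = 0.
  by move=> z0; apply/eqP; rewrite eq_le N_le0//= -N0 N_nondecr.
have : is_derive y (1 : R) N 0.
  apply: (derive1_at_max (a := 0) (b := y + y)).
  - lra.
  - by move=> t _; case: (dN t).
  - by rewrite in_itv/=; apply/andP; split; lra.
  - by move=> t; rewrite in_itv/= => /andP[t0 _]; rewrite !NE// ltW.
move=> /(is_derive_unique (dN y))/eqP.
rewrite subr_eq0 eqrXn2//; first by move=> /eqP.
  by case/andP: (rescale_in pq2 y0) => /ltW.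
by case/andP: (rescale_in pq1 y0) => /ltW.
Qed.

(** Equal rescalings have equal slopes, and every [t] in ]0, 1[ is one of their values. *)
Let gap_diff_eq0 (t : R) : 0 < t -> t < 1 -> gap_diff t = 0.
Proof.
move=> t0 t1; have [|y y0 Wy] := rescale_onto pq1 (t := t); first by rewrite t0.
have WE : is_derive y (1 : R) (rescale q1) (drescale q2 V2 y).
  apply: near_eq_is_derive (is_derive_rescale pq2 y).
  by near=> z; rewrite rescale_eq//; near: z; exact: lt_nbhsr.
have := drescale_sqr pq1 y; rewrite (is_derive_unique (is_derive_rescale pq1 y) WE).
rewrite (drescale_sqr pq2) -rescale_eq// Wy => /mulfI E.
by rewrite /gap_diff E ?subrr// mulf_neq0 ?pnatr_eq0// expf_neq0// gt_eqF.
Unshelve. all: by end_near. Qed.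

Let gamma_eq (t : R) : 0 < t -> t < 1 -> gamma (a1 * t) = gamma (a2 * t).
Proof.
move=> t0 t1.
have : is_derive t (1 : R) gap_diff 0.
  apply: (derive1_at_max (a := 0) (b := 1)) => //.
  - by move=> s; rewrite in_itv/= => /andP[s0 _]; case: (is_derive_gap_diff s0).
  - by rewrite in_itv/= t0.
  - by move=> s; rewrite in_itv/= => /andP[s0 s1]; rewrite !gap_diff_eq0.
move=> /(is_derive_unique (is_derive_gap_diff t0))/eqP.
rewrite mulf_eq0 expf_eq0/= (gt_eqF t0) orbF subr_eq0 => /eqP.
done.
Qed.

(** Equal heights undo the rescaling. Otherwise [gamma] is invariant under the dilation by
    [r = a1 / a2 < 1]; once [r ^+ n * t <= s], monotonicity squeezes [gamma s] between
    [gamma (r ^+ n * t)] and [gamma t], which are equal. *)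
Lemma profile_unique :
  q1 = q2 \/ forall s t, 0 < s -> s <= t -> t < a2 -> gamma s = gamma t.
Proof.
move: (a12); rewrite le_eqVlt => /predU1P[aE|a_lt]; [left|right].
  have E x : 0 < x -> q1 x = q2 x.
    move=> x0; have a_neq0 := lt0r_neq0 a2_gt0.
    have := @rescale_eq (a2 ^+ 2 * x); rewrite /rescale -/a1 -/a2 aE.
    rewrite mulKf ?expf_neq0// mulr_gt0 ?exprn_gt0// => /(_ isT).
    by move/(divIf a_neq0).
  apply/funext => x; have [x0|x0|<-] := ltgtP 0 x; [exact: E| |exact: aE].
  by rewrite -(profile_even pq1) -(profile_even pq2) E// oppr_gt0.
move=> s t s0 st ta; apply/eqP; rewrite eq_le.
rewrite (profile_gamma_le pq2 s0 st (ltW ta))/=.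
have t0 := lt_le_trans s0 st.
pose r := a1 / a2.
have r0 : 0 < r by rewrite divr_gt0.
have r1 : r < 1 by rewrite ltr_pdivrMr// mul1r.
have iter_eq n : gamma (r ^+ n * t) = gamma t.
  elim: n => [|n IH]; first by rewrite expr0 mul1r.
  have u0 : 0 < r ^+ n * t by rewrite mulr_gt0 ?exprn_gt0.
  have ua : r ^+ n * t < a2.
    by rewrite (le_lt_trans _ ta)// ger_pMl// exprn_ile1 ?ltW.
  rewrite -IH.
  have := gamma_eq (t := r ^+ n * t / a2).
  rewrite divr_gt0// ltr_pdivrMr// mul1r => /(_ isT ua).
  have a2_neq0 := lt0r_neq0 a2_gt0.
  have -> : a1 * (r ^+ n * t / a2) = r ^+ n.+1 * t by rewrite exprS /r; ring.
  by have -> : a2 * (r ^+ n * t / a2) = r ^+ n * t by field.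
have [n rn] : exists n, r ^+ n * t <= s.
  have rc : (fun n => r ^+ n) @ \oo --> (0 : R).
    by apply: cvg_expr; rewrite ger0_norm// ltW.
  have /(cvgr_lt _ rc) : 0 < s / t by rewrite divr_gt0.
  by move=> [N _ /(_ N (leqnn N))]/= /ltW h; exists N; rewrite -ler_pdivlMr.
rewrite -(iter_eq n).
by apply: (profile_gamma_le pq2) (ltW (le_lt_trans st ta)); rewrite ?mulr_gt0 ?exprn_gt0.
Qed.

End two_profiles.

Hypothesis G0 : G 0 = 0.
Hypothesis G10 : G1 0 = 0.
Hypothesis G20 : G2 0 = 0.

Lemma gamma_constant_critical (a : R) : 0 < a ->
  (forall s t, 0 < s -> s <= t -> t < a -> gamma s = gamma t) ->
  forall s, 0 < s <= a -> s * G1 s = 6 * G s.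
Proof.
move=> a0 gE.
pose phi s := s * G1 s - 6 * G s.
have dphi s : is_derive s (1 : R) phi (s * G2 s - 5 * G1 s).
  have := dG s; have := dG1 s => ? ?; apply: is_derive_eq.
  by rewrite /GRing.scale/=; ring.
pose k := gamma (a / 2).
have gk s : 0 < s -> s < a -> gamma s = k.
  move=> s0 sa; have [h|/ltW h] := lerP s (a / 2); first by apply: gE => //; lra.
  by symmetry; apply: gE => //; lra.
(* This is [phi s / s ^+ 2]. Its derivative vanishes as [gamma] is the constant [k], so [phi] is a
   multiple of [s ^+ 2]; the behaviour of [G] at 0 then shows that the multiple is 0. *)
pose c s := k * s ^+ 4 - 4 * quot2 s.
have c_const s t : 0 < s -> s <= t -> t < a -> c t = c s.
  move=> s0 st ta; apply/eqP; rewrite -subr_eq0.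
  have [|d /andP[sd dt] ->] := @mean_value R c (fun _ => 0) s t st; last by rewrite mul0r.
  move=> u /andP[su ut]; have u0 := lt_le_trans s0 su.
  have := is_derive_quot2 u0 => ?; apply: is_derive_eq.
  by rewrite (gk u) ?(le_lt_trans ut)// /GRing.scale/=; ring.
have phiE s : 0 < s -> s < a -> phi s = c s * s ^+ 2.
  move=> s0 sa; have s_neq0 : s != 0 by rewrite gt_eqF.
  by rewrite /c -(gk s)// /gamma /quot2 /phi; field.
(* Near 0, [|G2| <= e] gives [|s * G1 s| <= e * s ^+ 2] and [|6 * G s| <= 6 * e * s ^+ 2], whence
   the 7. *)
have c_small (e : R) : 0 < e -> exists2 s, 0 < s < a & `|c s| <= 7 * e.
  move=> e0; have /cvgrPdist_lt/(_ e e0)/nbhs_ballP[d /= d0 hd] := @cG2 (0 : R).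
  pose s := Num.min d a / 2.
  have m0 : 0 < Num.min d a by rewrite lt_min d0.
  have [md ma] : Num.min d a <= d /\ Num.min d a <= a by rewrite !ge_min !lexx orbT.
  have s0 : 0 < s by rewrite divr_gt0.
  have hG2 u : 0 <= u -> u <= s -> `|G2 u| <= e.
    move=> u0 us; have /hd : ball (0 : R) d u.
      by rewrite /ball/= sub0r normrN ger0_norm//; move: us; rewrite /s; lra.
    by rewrite G20 sub0r normrN => /ltW.
  have sa : s < a by rewrite /s; lra.
  clearbody s.
  have hG1 u : 0 <= u -> u <= s -> `|G1 u| <= e * u.
    move=> u0 us; have [v /andP[v0 vu]] := mean_value u0 (fun x _ => dG1 x).
    rewrite G10 !subr0 => ->; rewrite normrM (ger0_norm u0) ler_wpM2r//.
    by rewrite hG2// (le_trans vu).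
  have hG : `|G s| <= e * s ^+ 2.
    have [v /andP[v0 vs]] := mean_value (ltW s0) (fun x _ => dG x).
    rewrite G0 !subr0 => ->; rewrite normrM (gtr0_norm s0).
    have h : `|G1 v| <= e * s by rewrite (le_trans (hG1 _ v0 vs))// ler_wpM2l// ltW.
    by rewrite expr2 mulrA ler_wpM2r// ltW.
  exists s; first by rewrite s0.
  have : `|c s| * s ^+ 2 <= 7 * e * s ^+ 2.
    rewrite -[X in _ * X](ger0_norm (sqr_ge0 s)) -normrM -phiE// /phi.
    rewrite (le_trans (ler_normB _ _))// !normrM (gtr0_norm s0) (ger0_norm (ler0n _ 6)).
    have := hG1 s (ltW s0) (lexx _); have := s0; nra.
  by rewrite ler_pM2r// exprn_gt0.
have c0 s : 0 < s -> s < a -> c s = 0.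
  move=> s0 sa; apply/eqP; rewrite -normr_le0; apply/ler_addgt0Pr => e e0.
  have [|t /andP[t0 ta]] := c_small (e / 7); first by rewrite divr_gt0.
  have -> : c t = c s.
    by have [h|/ltW h] := lerP s t; [rewrite (c_const s t)|rewrite (c_const t s)].
  lra.
have phi0 s : 0 < s -> s < a -> phi s = 0.
  by move=> s0 sa; rewrite phiE// c0// mul0r.
have phi'0 s : 0 < s -> s < a -> s * G2 s - 5 * G1 s = 0.
  move=> s0 sa; apply: is_derive_unique (dphi s) _.
  apply: (derive1_at_max (a := 0) (b := a)) => //; first exact: ltW.
  - by rewrite in_itv/= s0.
  - by move=> u; rewrite in_itv/= => /andP[u0 ua]; rewrite !phi0.
move=> s /andP[s0]; rewrite le_eqVlt => /predU1P[->|sa]; apply/eqP;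
  rewrite -subr_eq0 -/(phi _); last by rewrite phi0.
(* The end [s = a] is reached by the mean value theorem on [[a / 2, a]]; it is needed because a
   profile takes the value [a] at 0. *)
have a2a : a / 2 < a by lra.
have cphi : {within `[a / 2, a], continuous phi}.
  exact: is_derive_within (fun x _ => dphi x).
have [u] := MVT a2a (fun u _ => dphi u) cphi.
rewrite in_itv/= => /andP[u1 u2]; rewrite phi'0//; last lra.
rewrite (phi0 (a / 2))//; last by rewrite divr_gt0.
by rewrite subr0 mul0r => ->.
Qed.

End profiles.

(** * Integrals and test functions *)

Section integrals_on_the_line.
Context {R : realType}.
Notation mu := (@lebesgue_measure R).
Implicit Types f g u v : R -> R.

Definition integrableT f := mu.-integrable setT (EFin \o f).

Lemma continuous_measurable f : continuous f -> measurable_fun setT f.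
Proof. exact: continuous_measurable_fun. Qed.

Lemma integrableT_measurable f : integrableT f -> measurable_fun setT f.
Proof. by move=> /(measurable_int mu)/measurable_EFinP. Qed.

Lemma integrableT_le f g : measurable_fun setT f -> integrableT g ->
  (forall x, `|f x| <= g x) -> integrableT f.
Proof.
move=> mf ig fg; apply: le_integrable ig => //; first exact/measurable_EFinP.
by move=> x _ /=; rewrite lee_fin (le_trans (fg x))// ler_norm.
Qed.

Lemma integrableTD f g : integrableT f -> integrableT g ->
  integrableT (fun x => f x + g x).
Proof. by move=> fi gi; have := integrableD measurableT fi gi. Qed.

Lemma integrableTZ (k : R) f : integrableT f -> integrableT (fun x => k * f x).
Proof. by move=> fi; have := integrableZl measurableT k fi. Qed.

Lemma integrableTN f : integrableT f -> integrableT (fun x => - f x).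
Proof. by move=> fi; have := integrableN fi. Qed.

Lemma RintegralN f : integrableT f -> \int[mu]_x (- f x) = - \int[mu]_x f x.
Proof.
move=> fi; rewrite -mulN1r -RintegralZl//.
by apply: eq_Rintegral => x _; rewrite mulN1r.
Qed.

Lemma Rintegral_compact f (a b : R) : (forall x, x < a -> f x = 0) ->
  (forall x, b < x -> f x = 0) -> \int[mu]_x f x = \int[mu]_(x in `[a, b]) f x.
Proof.
move=> fa fb; rewrite [RHS]Rintegral_mkcond; apply: eq_Rintegral => x _.
rewrite patchE; case: ifPn => //; rewrite notin_setE/= in_itv/= => /negP.
by rewrite negb_and -!ltNge => /orP[/fa|/fb].
Qed.

Lemma integrable_itv_restrict f (i : interval R) :
  mu.-integrable [set` i] (EFin \o f) <-> integrableT (f \_ [set` i]).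
Proof.
by rewrite /integrableT -restrict_EFin; apply: integrable_mkcond; exact: measurable_itv.
Qed.

Lemma Rintegral_dominated_cvg (f_ : nat -> R -> R) f g :
  (forall n, measurable_fun setT (f_ n)) ->
  (forall x, f_ n x @[n --> \oo] --> f x) -> integrableT g ->
  (forall n x, `|f_ n x| <= g x) ->
  integrableT f /\ \int[mu]_x f_ n x @[n --> \oo] --> \int[mu]_x f x.
Proof.
move=> mf_ fcvg ig fg.
have mf : measurable_fun setT f.
  by apply: (measurable_fun_cvg (h := f_)) => // x _; exact: fcvg.
have [] := @dominated_convergence _ _ R mu setT measurableT
  (fun n => EFin \o f_ n) (EFin \o f) (EFin \o g).
- by move=> n; apply/measurable_EFinP; exact: mf_.
- exact/measurable_EFinP.
- apply: aeW => x _; apply: cvg_EFin; first by near=> n.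
  exact: fcvg.
- exact: ig.
- by apply: aeW => x n _ /=; rewrite lee_fin.
move=> fi _ cf; split=> //; apply: fine_cvg.
by rewrite fineK//; apply: integrable_fin_num.
Unshelve. all: by end_near. Qed.

Lemma Rintegral_FTC f F (a b : R) : continuous f ->
  (forall x, is_derive x (1 : R) F (f x)) -> a <= b ->
  \int[mu]_(x in `[a, b]) f x = F b - F a.
Proof.
move=> cf dF; rewrite le_eqVlt => /predU1P[->|ab].
  by rewrite set_itv1 Rintegral_set1 subrr.
have cF : continuous F by exact: (is_derive_continuous dF).
rewrite /Rintegral (continuous_FTC2 (F := F) ab) -?EFinB//.
- exact: continuous_subspaceT.
- split; first by move=> x _; case: (dF x).
    exact: cvg_at_right_filter (cF a).
  exact: cvg_at_left_filter (cF b).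
- by move=> x _; rewrite derive1E; apply: derive_val.
Qed.

Lemma continuous_integrable_itv f (a b : R) : continuous f ->
  mu.-integrable `[a, b] (EFin \o f).
Proof.
move=> cf; apply: continuous_compact_integrable; first exact: segment_compact.
exact: continuous_subspaceT.
Qed.

(** An integral with a fixed lower end is a primitive only to the right of that end. The lower end
    [h x] therefore moves with [x], and subtracting the integral up to 0 makes the result
    independent of it. *)
Lemma exists_primitive f : continuous f ->
  exists F, forall x, is_derive x (1 : R) F (f x).
Proof.
move=> cf; pose I (a x : R) := \int[mu]_(t in `[a, x]) f t.
have IB (a b x : R) : a <= b -> b < x -> I a x = I a b + I b x.
  move=> ab bx; have := @Rintegral_itvB R f (BLeft a) (BRight x) b.
  rewrite !bnd_simp => /(_ (continuous_integrable_itv a x cf) ab (ltW bx)).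
  rewrite /I => /eqP; rewrite subr_eq addrC => /eqP ->.
  rewrite (@Rintegral_itv_obnd_cbnd _ b (BRight x)) //.
  apply: integrableS (continuous_integrable_itv b x cf) => //.
  exact: subset_itv_oc_cc.
pose h (x : R) := - (`|x| + 1).
pose F x := I (h x) x - I (h x) 0.
have FE (A x : R) : A <= h x -> F x = I A x - I A 0.
  move=> Ah; rewrite /F (IB A (h x) x)//.
    by rewrite (IB A (h x) 0)//; [ring|rewrite /h oppr_lt0 ltr_wpDl].
  by rewrite /h; have := ler_norm (- x); rewrite normrN; lra.
exists F => x.
(* The end [h x - 1] is admissible in [FE] for all [y] within distance 1 of [x]. *)
have [] := @continuous_FTC1_closed R f (h x - 1) x (x + 1).
- by rewrite ltrDl.
- exact: continuous_integrable_itv.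
- by rewrite /h; have := ler_norm (- x); rewrite normrN; lra.
- exact: cf.
move=> dI; rewrite derive1E => ID.
have : is_derive x (1 : R) (fun y => I (h x - 1) y - I (h x - 1) 0) (f x).
  have : is_derive x (1 : R) (I (h x - 1)) (f x) by split.
  by move=> ?; apply: is_derive_eq; rewrite subr0.
apply: near_eq_is_derive; near=> y; rewrite (FE (h x - 1))//.
have : `|x - y| < 1.
  near: y; apply: (@cvgr_dist_lt _ _ _ (nbhs x) _ id x) => //; exact: cvg_id.
have := ler_distD x y 0; rewrite !subr0 distrC /h; lra.
Unshelve. all: by end_near. Qed.

End integrals_on_the_line.

(** * Test functions: compact supports, primitives and a smooth step *)

Section test_functions.
Context {R : realType}.
Notation mu := (@lebesgue_measure R).
Implicit Types f g u v phi dphi : R -> R.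

Lemma test_fun_of phi dphi (M : R) :
  (forall x, is_derive x (1 : R) phi (dphi x)) -> continuous dphi ->
  (forall x, M < `|x| -> phi x = 0) -> test_fun phi /\ derive1 phi = dphi.
Proof.
move=> h c0 hM; have E : derive1 phi = dphi.
  by apply/funext => x; rewrite derive1E; have := h x => ?; exact: derive_val.
split=> //; split; [by move=> x; case: (h x)|by rewrite E|by exists M].
Qed.

Lemma test_fun_is_derive phi : test_fun phi ->
  forall x, is_derive x (1 : R) phi (derive1 phi x).
Proof. by move=> [dphi _ _] x; rewrite derive1E; exact/derivableP. Qed.

Lemma test_fun_continuous phi : test_fun phi -> continuous phi.
Proof. by move=> /test_fun_is_derive h; exact: (is_derive_continuous h). Qed.

Lemma derive1_compact phi (M : R) : (forall x, M < `|x| -> phi x = 0) ->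
  forall x, M < `|x| -> derive1 phi x = 0.
Proof.
move=> hM x Mx; rewrite derive1E; apply: derive_val.
have near0 : \forall y \near x, cst 0 y = phi y.
  have /(cvgr_gt _ (@norm_continuous _ _ x)) := Mx.
  by apply: filterS => y /hM ->.
exact: near_eq_is_derive near0 (is_derive_cst _ _ _).
Qed.

Lemma locally_integrable_itv u (a b : R) : locally_integrable setT u ->
  mu.-integrable `[a, b] (EFin \o u).
Proof.
move=> [mu_ _ iu]; apply/integrableP; split.
  exact/measurable_EFinP/measurable_funTS.
by apply: iu => //; exact: segment_compact.
Qed.

Lemma locally_integrable_mul u phi (M : R) : locally_integrable setT u ->
  continuous phi -> (forall x, M < `|x| -> phi x = 0) ->
  integrableT (fun x => u x * phi x).
Proof.
move=> locu cphi hM; have [mu_ _ _] := locu.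
have [L L0 hL] := continuous_segment_bounded (- M) M cphi.
have iK : integrableT (fun x => L * `|(u \_ `[- M, M]) x|).
  apply: integrableTZ; apply: integrable_norm.
  exact/integrable_itv_restrict/locally_integrable_itv.
apply: integrableT_le iK _.
  by apply: measurable_funM => //; exact: continuous_measurable.
move=> x; rewrite patchE normrM mulrC; case: ifPn => [|].
  by rewrite inE/= in_itv/= => xM; rewrite ler_wpM2r// hL.
rewrite notin_setE/= in_itv/= -ler_norml => /negP; rewrite -ltNge => /hM ->.
by rewrite normr0 mul0r mulr_ge0.
Qed.

Lemma continuous_locally_integrable f : continuous f -> locally_integrable setT f.
Proof.
move=> cf; split; [exact: continuous_measurable|exact: openT|move=> K _ cK].
have := continuous_compact_integrable cK (continuous_subspaceT cf).
by case/integrableP.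
Qed.

Lemma test_mul_integrable u phi : locally_integrable setT u -> test_fun phi ->
  integrableT (fun x => u x * phi x).
Proof.
move=> iu tphi; have [_ _ [M hM]] := tphi.
exact: locally_integrable_mul (test_fun_continuous tphi) hM.
Qed.

Lemma derive_test_mul_integrable u phi : locally_integrable setT u ->
  test_fun phi -> integrableT (fun x => u x * derive1 phi x).
Proof.
move=> iu [_ cphi [M hM]]; apply: locally_integrable_mul cphi _ => //.
exact: derive1_compact hM.
Qed.

(** [F] is constant on each side of the support, and the two constants differ by the integral of
    [f], which is 0. *)
Lemma compact_support_primitive f F (M : R) :
  continuous f -> (forall x, is_derive x (1 : R) F (f x)) -> 0 <= M ->
  (forall x, M < `|x| -> f x = 0) -> \int[mu]_x f x = 0 ->
  forall x, M < `|x| -> F x - F (- M) = 0.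
Proof.
move=> cf dF M0 hM f0 x Mx.
have flat a b : a <= b -> (forall y, a < y -> y < b -> M < `|y|) -> F b = F a.
  by move=> ab h; apply: (is_derive_zero_const ab dF) => y ay yb; rewrite hM ?h.
have [x0|x0] := lerP 0 x.
  have FM : F M - F (- M) = 0.
    rewrite -(Rintegral_FTC cf dF); last lra.
    rewrite -Rintegral_compact// => y yM; apply: hM.
      by rewrite ltr0_norm; lra.
    by rewrite gtr0_norm; lra.
  rewrite ger0_norm// in Mx; rewrite (flat M x) ?FM ?(ltW Mx)// => y My _.
  by rewrite gtr0_norm// (le_lt_trans M0).
rewrite ltr0_norm// in Mx; rewrite -(flat x (- M)) ?subrr//; first lra.
by move=> y _ yM; rewrite ltr0_norm; lra.
Qed.

(* A C^1 transition from 0 on ]-oo, -1] to 1 on [1, +oo[ *)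
Lemma exists_smooth_step : exists S eta : R -> R, exists L : R,
  [/\ forall x, is_derive x (1 : R) S (eta x), continuous eta,
      forall x, 0 <= eta x <= L, forall x, 1 < `|x| -> eta x = 0 &
      [/\ forall x, x <= -1 -> S x = 0, forall x, 1 <= x -> S x = 1 &
      forall x, 0 <= S x <= 1]].
Proof.
(* A continuous bump is enough, as test functions need only be C^1. *)
pose tent (x : R) : R := Num.max 0 (1 - `|x|).
have ctent : continuous tent.
  move=> x; apply: (@continuous_max _ _ (cst 0) (fun x => 1 - `|x|) x).
    exact: cst_continuous.
  by apply: cvgB; [exact: cvg_cst|exact: norm_continuous].
have tent_ge0 x : 0 <= tent x by rewrite le_max lexx.
have tent0 x : 1 < `|x| -> tent x = 0.
  by move=> x1; apply/max_idPl; lra.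
have [F dF] := exists_primitive ctent.
have F_nd x y : x <= y -> F x <= F y.
  by move=> xy; apply: (is_derive_nondecr xy (fun x _ => dF x)).
pose N := F 1 - F (-1).
have N0 : 0 < N.
  rewrite subr_gt0; have m11 : -1 < 1 :> R by lra.
  have cNF y : is_derive y (1 : R) (fun y => - F y) (- tent y).
    by have := dF y => ?; exact: is_deriveN.
  rewrite -ltrN2; apply: (is_derive_decr m11 (fun x _ => cNF x)) => x /andP[x1 x2].
  by rewrite oppr_lt0 lt_max subr_gt0 ltr_norml x1 x2 orbT.
have flat a b : a <= b -> (forall y, a < y -> y < b -> 1 < `|y|) -> F b = F a.
  by move=> ab h; apply: (is_derive_zero_const ab dF) => y ay yb; rewrite tent0 ?h.
have Sle x : x <= -1 -> F x = F (-1).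
  move=> x1; apply/esym/flat => // y _ y1; rewrite ltr0_norm; lra.
have Sge x : 1 <= x -> F x = F 1.
  move=> x1; apply/flat => // y y1 _; rewrite gtr0_norm; lra.
exists (fun x => N^-1 * (F x - F (-1))), (fun x => N^-1 * tent x), N^-1; split.
- move=> x; have := dF x => ?; apply: is_derive_eq.
  by rewrite /GRing.scale/= subr0.
- by move=> x; apply: (@continuousM _ _ (cst N^-1) tent); [exact: cst_continuous|exact: ctent].
- move=> x; rewrite mulr_ge0 ?invr_ge0 ?(ltW N0)//= ger_pMr ?invr_gt0//.
  by rewrite ge_max ler01 gerBl normr_ge0.
- by move=> x x1; rewrite tent0// mulr0.
- split.
  + by move=> x x1; rewrite Sle// subrr mulr0.
  + by move=> x x1; rewrite Sge// mulVf// gt_eqF.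
  + move=> x.
    have Fx : F (-1) <= F x <= F 1.
      apply/andP; split.
        by have [h|/ltW/Sle ->//] := lerP (-1) x; exact: F_nd.
      by have [h|/ltW/Sge ->//] := lerP x 1; exact: F_nd.
    case/andP: Fx => l1 l2; rewrite mulr_ge0 ?invr_ge0 ?(ltW N0) ?subr_ge0//=.
    by rewrite ler_pdivrMl// mulr1 lerD2r.
Qed.

End test_functions.

(** * The fundamental lemma and the du Bois-Reymond lemma *)

Section du_bois_reymond.
Context {R : realType}.
Notation mu := (@lebesgue_measure R).
Implicit Types f g u v phi : R -> R.

Lemma Rintegral_test_zero_itv u (a b : R) : locally_integrable setT u ->
  (forall phi, test_fun phi -> \int[mu]_x (u x * phi x) = 0) -> a < b ->
  \int[mu]_(x in `]a, b]) u x = 0.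
Proof.
move=> locu u0 ab; have [mu_ _ _] := locu.
have [S [eta [L [dS ceta eta_in eta0 [S0 S1 S01]]]]] := @exists_smooth_step R.
(* The shift by 1 makes the step vanish for all [x <= c], including [c], so that [st a n - st b n]
   tends to the indicator of ]a, b] at every point. *)
pose st (c : R) (n : nat) (x : R) := S (n.+1%:R * x + (- n.+1%:R * c - 1)).
have dst c n := is_derive_affine_arg n.+1%:R (- n.+1%:R * c - 1) dS.
have st_cvg (c x : R) : (fun n => st c n x) @ \oo --> (if c < x then 1 else 0 : R).
  have [cx|xc] := ltP c x; last first.
    apply: cvg_near_cst; near=> n; rewrite /st S0//.
    have : n.+1%:R * (x - c) <= 0 :> R by rewrite mulr_ge0_le0// subr_le0.
    lra.
  apply: cvg_near_cst; near=> n; rewrite /st S1//.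
  have : 2 / (x - c) <= n.+1%:R.
    rewrite (@le_trans _ _ n%:R) ?ler_nat//.
    by near: n; exact: nbhs_infty_ger.
  by rewrite ler_pdivrMr ?subr_gt0//; lra.
pose phi n x := st a n x - st b n x.
have phi_out n (x : R) : Num.max `|a| `|b| + 2 < `|x| -> phi n x = 0.
  set A := Num.max _ _.
  have [Aa Ab] : `|a| <= A /\ `|b| <= A by rewrite !le_max !lexx orbT.
  have := ler_norm a; have := ler_norm b; have := ler_norm (- a); have := ler_norm (- b).
  rewrite !normrN => ? ? ? ?.
  have n1 : 1 <= n.+1%:R :> R by rewrite ler1n.
  rewrite /phi /st; have [x0|x0] := lerP 0 x.
    rewrite ger0_norm// => Ax.
    have xa : 2 <= n.+1%:R * (x - a) by nra.
    have xb : 2 <= n.+1%:R * (x - b) by nra.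
    by rewrite !S1 ?subrr//; lra.
  rewrite ltr0_norm// => Ax.
  have xa : n.+1%:R * (x - a) <= 0 by nra.
  have xb : n.+1%:R * (x - b) <= 0 by nra.
  by rewrite !S0 ?subrr//; lra.
have tphi n : test_fun (phi n).
  have [] := test_fun_of (phi := phi n) (dphi := fun x =>
    n.+1%:R * eta (n.+1%:R * x + (- n.+1%:R * a - 1)) -
    n.+1%:R * eta (n.+1%:R * x + (- n.+1%:R * b - 1))) _ _ (phi_out n).
  - by move=> x; apply: cvgB; exact: continuous_affine_arg.
  - by [].
have phi_le1 n (x : R) : `|phi n x| <= 1.
  have /andP[? ?] := S01 (n.+1%:R * x + (- n.+1%:R * a - 1)).
  have /andP[? ?] := S01 (n.+1%:R * x + (- n.+1%:R * b - 1)).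
  by rewrite /phi /st ler_norml; apply/andP; split; lra.
pose A : R := Num.max `|a| `|b| + 2.
pose g (x : R) := `|(u \_ `[- A, A]) x|.
have ig : integrableT g.
  apply: integrable_norm.
  exact/integrable_itv_restrict/locally_integrable_itv.
have mphi n : measurable_fun setT (fun x => u x * phi n x).
  exact: integrableT_measurable (test_mul_integrable locu (tphi n)).
have phi_g n x : `|u x * phi n x| <= g x.
  rewrite normrM /g patchE; case: ifPn => [_|].
    by rewrite ler_piMr.
  rewrite notin_setE/= in_itv/= -ler_norml => /negP; rewrite -ltNge => /phi_out ->.
  by rewrite normr0 mulr0.
have lim_phi x : u x * phi n x @[n --> \oo] --> (u \_ `]a, b]) x.
  have -> : (u \_ `]a, b]) x = u x * ((if a < x then 1 else 0) - (if b < x then 1 else 0)).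
    rewrite patchE mem_setE in_itv/= [x <= b]leNgt.
    case: ltP => ax /=; case: ltP => bx /=; rewrite ?subrr ?subr0 ?mulr0 ?mulr1//.
    by move: (lt_le_trans ab (le_trans (ltW bx) ax)); rewrite ltxx.
  by apply: cvgM; [exact: cvg_cst|apply: cvgB; exact: st_cvg].
have [_] := Rintegral_dominated_cvg mphi lim_phi ig phi_g.
rewrite [in X in X -> _](_ : (fun n => _) = cst 0); last first.
  by apply/funext => n; exact: u0.
rewrite -Rintegral_mkcond => /(cvg_lim (@Rhausdorff R)) <-.
by apply: cvg_lim; [exact: Rhausdorff|exact: cvg_cst].
Unshelve. all: by end_near. Qed.

(** At a Lebesgue point [x], [u x] is the derivative of the integral of [u] from [x - 1], which is
    identically 0. *)
Lemma test_zero_ae u : locally_integrable setT u ->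
  (forall phi, test_fun phi -> \int[mu]_x (u x * phi x) = 0) ->
  {ae mu, forall x, u x = 0}.
Proof.
move=> locu u0; have [mu_ _ iu] := locu.
have := lebesgue_differentiation locu.
apply: filterS; first exact: (ae_filter_ringOfSetsType mu).
move=> x lx.
have [||| |_ <-] := @FTC1_lebesgue_pt R u (BRight (x - 1)) x (x + 1).
- by rewrite ltrDl.
- apply: integrableS (locally_integrable_itv (x - 1) (x + 1) locu) => //.
  exact: subset_itv_oc_cc.
- by rewrite /Order.lt/= ltrBlDr ltrDl.
- by [].
rewrite [X in derive1 X](_ : _ = cst 0) ?derive1_cst//.
apply/funext => y; have [h|h] := ltP (x - 1) y.
  exact: Rintegral_test_zero_itv.
by rewrite set_itv_ge ?Rintegral_set0// bnd_simp -leNgt.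
Qed.

(** For a test function [eta], subtracting its integral times the unit bump [e0] leaves a function
    of mean zero, that is, the derivative of a test function. Hence [u - c] annihilates [eta], where
    [c] is the integral of [u * e0]. *)
Lemma derive_test_zero_ae_cst u : locally_integrable setT u ->
  (forall phi, test_fun phi -> \int[mu]_x (u x * derive1 phi x) = 0) ->
  exists c, {ae mu, forall x, u x = c}.
Proof.
move=> locu u0.
have [S [e0 [L [dS ce0 e0_in e00 [S0 S1 S01]]]]] := @exists_smooth_step R.
have ie0 : \int[mu]_x e0 x = 1.
  rewrite (@Rintegral_compact _ e0 (-1) 1).
  - by rewrite (Rintegral_FTC ce0 dS); [rewrite (S1 1)// (S0 (-1))// subr0|lra].
  - by move=> x x1; apply: e00; rewrite ltr0_norm; lra.
  - by move=> x x1; apply: e00; rewrite gtr0_norm; lra.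
have ue0 : integrableT (fun x => u x * e0 x) by exact: locally_integrable_mul locu ce0 e00.
pose c := \int[mu]_x (u x * e0 x); exists c.
have locc : locally_integrable setT (cst (- c)).
  by apply: continuous_locally_integrable; exact: cst_continuous.
have locuc : locally_integrable setT (fun x => u x - c).
  exact: locally_integrableD locu locc.
suff : {ae mu, forall x, u x - c = 0}.
  apply: filterS; first exact: (ae_filter_ringOfSetsType mu).
  by move=> x /eqP; rewrite subr_eq0 => /eqP.
apply: test_zero_ae => // eta teta; have [_ _ [M hM]] := teta.
have ceta := test_fun_continuous teta.
have ueta := test_mul_integrable locu teta.
have ieta : integrableT eta.
  have : integrableT (fun x => cst 1 x * eta x).
    apply: locally_integrable_mul ceta hM.
    by apply: continuous_locally_integrable; exact: cst_continuous.
  by under [X in integrableT X]eq_fun do rewrite mul1r.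
have ie : integrableT e0.
  have : integrableT (fun x => cst 1 x * e0 x).
    apply: locally_integrable_mul ce0 e00.
    by apply: continuous_locally_integrable; exact: cst_continuous.
  by under [X in integrableT X]eq_fun do rewrite mul1r.
pose I := \int[mu]_x eta x.
pose z (x : R) : R := eta x - I * e0 x.
have cz : continuous z.
  by move=> x; apply: cvgB; [exact: ceta|apply: cvgM; [exact: cvg_cst|exact: ce0]].
pose K : R := Num.max `|M| 1.
have [MK K1] : M <= K /\ 1 <= K.
  by rewrite !le_max lexx orbT ler_norm.
have zK x : K < `|x| -> z x = 0.
  by move=> Kx; rewrite /z hM ?e00 ?mulr0 ?subrr//; [exact: le_lt_trans Kx|exact: le_lt_trans Kx].
have iz : \int[mu]_x z x = 0.
  by rewrite RintegralB ?RintegralZl ?ie0 ?mulr1 ?subrr//; exact: integrableTZ.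
have [Z dZ] := exists_primitive cz.
have K0 : 0 <= K by rewrite (le_trans ler01).
have Zout := compact_support_primitive cz dZ K0 zK iz.
have dZ' x : is_derive x (1 : R) (fun y => Z y - Z (- K)) (z x).
  by have := dZ x => ?; apply: is_derive_eq; rewrite subr0.
have [tZ Z'] := test_fun_of dZ' cz Zout.
have := u0 _ tZ; rewrite Z'.
under eq_Rintegral do rewrite /z mulrBr mulrCA.
rewrite RintegralB ?RintegralZl//; last exact: integrableTZ.
rewrite -/c => E.
under eq_Rintegral do rewrite mulrBl.
by rewrite RintegralB ?RintegralZl//; [rewrite mulrC|exact: integrableTZ].
Qed.

End du_bois_reymond.

(** * Weak derivatives *)

Section weak_derivatives.
Context {R : realType}.
Notation mu := (@lebesgue_measure R).
Implicit Types f g u v w phi : R -> R.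

Lemma Rintegral_ae f g : measurable_fun setT f -> measurable_fun setT g ->
  {ae mu, forall x, f x = g x} -> \int[mu]_x f x = \int[mu]_x g x.
Proof.
move=> mf mg fg; congr fine; apply: ae_eq_integral => //.
- exact/measurable_EFinP.
- exact/measurable_EFinP.
- apply: filterS fg; first exact: (ae_filter_ringOfSetsType mu).
  by move=> x -> _.
Qed.

Lemma integrableT_ae f g : measurable_fun setT g -> integrableT f ->
  {ae mu, forall x, f x = g x} -> integrableT g.
Proof.
move=> mg fi fg; have mf := integrableT_measurable fi.
move/integrableP : fi => [_ fi]; apply/integrableP; split; first exact/measurable_EFinP.
suff -> : (\int[mu]_x `|(EFin \o g) x| = \int[mu]_x `|(EFin \o f) x|)%E by [].
apply: ae_eq_integral => //.
- by apply: measurableT_comp => //; exact/measurable_EFinP.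
- by apply: measurableT_comp => //; exact/measurable_EFinP.
- apply: filterS fg; first exact: (ae_filter_ringOfSetsType mu).
  by move=> x /= E _; rewrite E.
Qed.

Lemma is_wderiv_unique u v w : is_wderiv u v -> is_wderiv u w ->
  {ae mu, forall x, v x = w x}.
Proof.
move=> [_ locv Hv] [_ locw Hw].
have : {ae mu, forall x, v x - w x = 0}.
  apply: test_zero_ae; first exact: locally_integrableB.
  move=> phi tphi; under eq_Rintegral do rewrite mulrBl.
  rewrite RintegralB ?test_mul_integrable//; try exact: test_mul_integrable.
  apply/eqP; rewrite subr_eq0; apply/eqP/oppr_inj.
  by rewrite -Hv// -Hw.
apply: filterS; first exact: (ae_filter_ringOfSetsType mu).
by move=> x /eqP; rewrite subr_eq0 => /eqP.
Qed.

Lemma is_wderiv_ae u v w : is_wderiv u v -> locally_integrable setT w ->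
  {ae mu, forall x, v x = w x} -> is_wderiv u w.
Proof.
move=> [locu locv Hv] locw vw; split=> // phi tphi; rewrite Hv//; congr (- _).
apply: Rintegral_ae.
- exact: integrableT_measurable (test_mul_integrable locv tphi).
- exact: integrableT_measurable (test_mul_integrable locw tphi).
- apply: filterS vw; first exact: (ae_filter_ringOfSetsType mu).
  by move=> x ->.
Qed.

Lemma is_wderivD u v u' v' : is_wderiv u u' -> is_wderiv v v' ->
  is_wderiv (fun x => u x + v x) (fun x => u' x + v' x).
Proof.
move=> [lu lu' Hu] [lv lv' Hv]; split; [exact: locally_integrableD lu lv|
  exact: locally_integrableD lu' lv'|].
move=> phi tphi.
under eq_Rintegral do rewrite mulrDl.
under [in RHS]eq_Rintegral do rewrite mulrDl.
rewrite !RintegralD//; try exact: derive_test_mul_integrable.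
- by rewrite Hu// Hv// opprD.
- exact: test_mul_integrable.
- exact: test_mul_integrable.
Qed.

Lemma locally_integrableZ (k : R) u : locally_integrable setT u ->
  locally_integrable setT (fun x => k * u x).
Proof.
move=> [mu_ oT iu]; split=> //; first exact: measurable_funM.
move=> K KT cK; under eq_integral do rewrite normrM EFinM.
rewrite ge0_integralZl//.
- by rewrite lte_mul_pinfty ?lee_fin// iu.
- exact: compact_measurable.
- by apply: measurableT_comp => //; apply: measurableT_comp => //; exact: measurable_funTS.
Qed.

Lemma is_wderivZ (k : R) u u' : is_wderiv u u' ->
  is_wderiv (fun x => k * u x) (fun x => k * u' x).
Proof.
move=> [lu lu' Hu]; split; [exact: locally_integrableZ lu|
  exact: locally_integrableZ lu'|].
move=> phi tphi.
under eq_Rintegral do rewrite -mulrA.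
under [in RHS]eq_Rintegral do rewrite -mulrA.
rewrite !RintegralZl ?Hu ?mulrN//; first exact: test_mul_integrable.
exact: derive_test_mul_integrable.
Qed.

Lemma is_derive_is_wderiv u v : (forall x, is_derive x (1 : R) u (v x)) ->
  continuous v -> is_wderiv u v.
Proof.
move=> du cv.
have cu : continuous u by exact: (is_derive_continuous du).
have lu := continuous_locally_integrable cu.
have lv := continuous_locally_integrable cv.
split=> // phi tphi; apply/eqP; rewrite -addr_eq0; apply/eqP.
have iu := derive_test_mul_integrable lu tphi.
have iv := test_mul_integrable lv tphi.
rewrite -RintegralD//.
(* The end [|M| + 1] is strictly beyond [M], so that [phi] vanishes at the ends of the segment
   themselves. *)
have [_ cphi [M hM]] := tphi; have M0 : M < `|M| + 1 by rewrite (le_lt_trans (ler_norm M))// ltrDl.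
have N0 : 0 < `|M| + 1 by rewrite ltr_wpDl.
set N := `|M| + 1 in M0 N0.
have out x : N < `|x| -> u x * derive1 phi x + v x * phi x = 0.
  move=> Nx; have Mx := lt_trans M0 Nx.
  by rewrite hM// (derive1_compact hM)// !mulr0 addr0.
rewrite (@Rintegral_compact _ _ (- N) N).
- have dp x : is_derive x (1 : R) (fun x => u x * phi x) (u x * derive1 phi x + v x * phi x).
    have := du x; have := test_fun_is_derive tphi x => ? ?; apply: is_derive_eq.
    by rewrite /GRing.scale/=; ring.
  rewrite (Rintegral_FTC _ dp).
  + by rewrite !hM ?normrN ?gtr0_norm// !mulr0 subrr.
  + move=> x; apply: cvgD; apply: cvgM; [exact: cu|exact: cphi|exact: cv|].
    exact: (test_fun_continuous tphi).
  + lra.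
- by move=> x xN; apply: out; rewrite ltr0_norm; lra.
- by move=> x xN; apply: out; rewrite gtr0_norm; lra.
Qed.

Lemma test_fun_is_wderiv phi : test_fun phi -> is_wderiv phi (derive1 phi).
Proof.
move=> tphi; apply: is_derive_is_wderiv; first exact: test_fun_is_derive.
by case: tphi.
Qed.

(** [v] minus a primitive of [w] annihilates every derivative of a test function, hence is almost
    everywhere constant. *)
Lemma wderiv_continuous_regular v w : is_wderiv v w -> continuous w ->
  exists2 V, (forall x, is_derive x (1 : R) V (w x)) & {ae mu, forall x, v x = V x}.
Proof.
move=> [lv lw Hv] cw; have [W dW] := exists_primitive cw.
have [lW _ HW] := is_derive_is_wderiv dW cw.
have [|c hc] := derive_test_zero_ae_cst (locally_integrableB lv lW).
  move=> phi tphi; under eq_Rintegral do rewrite mulrBl.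
  rewrite RintegralB ?Hv ?HW ?subrr//; exact: derive_test_mul_integrable.
exists (fun x => W x + c).
  by move=> x; have := dW x => ?; apply: is_derive_eq; rewrite addr0.
apply: filterS hc; first exact: (ae_filter_ringOfSetsType mu).
by move=> x <-; rewrite addrC subrK.
Qed.

Lemma ae_eq_continuous f g : continuous f -> continuous g ->
  {ae mu, forall x, f x = g x} -> f = g.
Proof.
move=> cf cg [N [mN N0 hN]]; apply/funext => x; apply: contrapT => /eqP fgx.
have cfg : {for x, continuous (fun y => f y - g y)} by apply: cvgB; [exact: cf|exact: cg].
have : \forall y \near (x : R), 0 < `|f y - g y|.
  have c : {for x, continuous (fun y => `|f y - g y|)}.
    exact: continuous_comp cfg (@norm_continuous _ _ _).
  by have /cvgr_gt := c; apply; rewrite normr_gt0 subr_eq0.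
move/nbhs_ballP => -[r /= r0 hr].
have : (mu (ball x r) <= mu N)%E.
  apply: le_measure; rewrite ?inE//; first exact: measurable_ball.
  move=> y /hr; rewrite normr_gt0 subr_eq0 => fgy; apply: hN => /= E.
  by rewrite E eqxx in fgy.
by rewrite N0 (lebesgue_measure_ball _ (ltW r0)) leNgt lte_fin mulrn_wgt0.
Qed.

End weak_derivatives.

(** * Square integrable functions and the Sobolev bound *)

Section square_integrable.
Context {R : realType}.
Notation mu := (@lebesgue_measure R).
Implicit Types f g u v w phi : R -> R.
Local Notation L2 := (Lfun mu 2%:E).

Lemma L2_measurable f : f \in L2 -> measurable_fun setT f.
Proof. by rewrite inE => /andP[]; rewrite inE. Qed.

Lemma L2_sqr f : f \in L2 -> integrableT (fun x => f x ^+ 2).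
Proof. exact: Lfun2_integrable_sqr. Qed.

Lemma L2_of_sqr f : measurable_fun setT f -> integrableT (fun x => f x ^+ 2) ->
  f \in L2.
Proof.
move=> mf /integrableP[_ fi]; rewrite inE; apply/andP; split; rewrite inE//=.
rewrite /finite_norm unlock /Lnorm poweR_lty//; apply: le_lt_trans fi.
rewrite le_eqVlt; apply/orP; left; apply/eqP; apply: eq_integral => x _ /=.
by rewrite powR_mulrn// normrX.
Qed.

Lemma L2_mul f g : f \in L2 -> g \in L2 -> integrableT (fun x => f x * g x).
Proof. by move=> lf lg; apply/Lfun1_integrable; exact: Lfun2_mul_Lfun1. Qed.

Lemma L2_scale (k : R) f : f \in L2 -> (fun x => k * f x) \in L2.
Proof.
move=> lf; apply: L2_of_sqr.
  by apply: measurable_funM => //; exact: L2_measurable.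
under eq_fun do rewrite exprMn.
exact/integrableTZ/L2_sqr.
Qed.

Lemma L2_opp f : f \in L2 -> (fun x => - f x) \in L2.
Proof.
move=> lf; have -> : (fun x => - f x) = (fun x => -1 * f x).
  by apply/funext => x; rewrite mulN1r.
exact: L2_scale.
Qed.

Lemma L2_add f g : f \in L2 -> g \in L2 -> (fun x => f x + g x) \in L2.
Proof.
move=> lf lg; apply: L2_of_sqr.
  by apply: measurable_funD; exact: L2_measurable.
have -> : (fun x => (f x + g x) ^+ 2) =
    (fun x => f x ^+ 2 + g x ^+ 2 + 2 * (f x * g x)).
  by apply/funext => x; ring.
apply: integrableTD; last exact/integrableTZ/L2_mul.
by apply: integrableTD; exact: L2_sqr.
Qed.

Lemma L2_compact f (M : R) : continuous f -> (forall x, M < `|x| -> f x = 0) ->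
  f \in L2.
Proof.
move=> cf hM; apply: L2_of_sqr; first exact: continuous_measurable.
under eq_fun do rewrite expr2.
exact: locally_integrable_mul (continuous_locally_integrable cf) cf hM.
Qed.

Lemma test_fun_L2 phi : test_fun phi -> phi \in L2.
Proof.
by move=> tphi; have [_ _ [M hM]] := tphi; exact: L2_compact (test_fun_continuous tphi) hM.
Qed.

Lemma derive_test_fun_L2 phi : test_fun phi -> derive1 phi \in L2.
Proof. by move=> [_ cphi [M hM]]; exact: L2_compact cphi (derive1_compact hM). Qed.

Lemma Rintegral_bump (S eta : R -> R) (k c : R) : 0 < k ->
  (forall x, is_derive x (1 : R) S (eta x)) -> continuous eta ->
  (forall x, 1 < `|x| -> eta x = 0) -> S 1 = 1 -> S (-1) = 0 ->
  \int[mu]_x (k * eta (k * x + c)) = 1.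
Proof.
move=> k0 dS ceta eta0 S1 S0; have kn0 := lt0r_neq0 k0.
have e1 : k * ((-1 - c) / k) + c = -1 by field.
have e2 : k * ((1 - c) / k) + c = 1 by field.
rewrite (@Rintegral_compact _ _ ((-1 - c) / k) ((1 - c) / k)).
- rewrite (Rintegral_FTC _ (is_derive_affine_arg k c dS)).
  + by rewrite e1 e2 S1 S0 subr0.
  + exact: continuous_affine_arg.
  + by rewrite ler_pM2r ?invr_gt0//; lra.
- move=> x; rewrite ltr_pdivlMr// => h; rewrite eta0 ?mulr0//.
  by rewrite ltr0_norm; lra.
- move=> x; rewrite ltr_pdivrMr// => h; rewrite eta0 ?mulr0//.
  by rewrite gtr0_norm; lra.
Qed.

(** The Sobolev embedding, obtained by testing with a steep step minus a flat one, both centred at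
    [y]. The derivative is a narrow unit bump [bk], against which [u] integrates to nearly [u y],
    minus a wide one [b1], against which it is controlled by its L^2 norm. *)
Lemma is_wderiv_bounded_above u v : continuous u -> u \in L2 -> v \in L2 ->
  is_wderiv u v -> exists B, forall x, u x <= B.
Proof.
move=> cu lu lv [locu locv Hu].
have [S [eta [L [dS ceta eta_in eta0 [S0 S1 S01]]]]] := @exists_smooth_step R.
(* Both halves come from [2 * x * y <= x ^+ 2 + y ^+ 2]: [b1 ^+ 2 <= L * b1] has integral at most
   [L], and [phi ^+ 2] is at most the indicator of an interval of length 2. *)
pose B := 2^-1 * (\int[mu]_x (u x ^+ 2) + L) + 2^-1 * (\int[mu]_x (v x ^+ 2) + 2).
exists B => y; rewrite leNgt; apply/negP => By.
pose K := (B + u y) / 2.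
have [BK Ky] : B < K /\ K < u y by rewrite /K; split; lra.
have /(cvgr_gt _ (cu y))/nbhs_ballP[d /= d0 hd] := Ky.
pose e := Num.min d 1 / 2.
have m0 : 0 < Num.min d 1 by rewrite lt_min d0/=.
have [md m1] : Num.min d 1 <= d /\ Num.min d 1 <= 1 by rewrite !ge_min !lexx orbT.
have [e0 ed e1] : [/\ 0 < e, e < d & e <= 1] by rewrite /e; split; lra.
pose k := e^-1.
have k0 : 0 < k by rewrite invr_gt0.
have k1 : 1 <= k by rewrite invf_ge1.
have kE : k^-1 = e by rewrite invrK.
clearbody k; clearbody e.
pose bk (x : R) := k * eta (k * x + - k * y).
pose b1 (x : R) := 1 * eta (1 * x + - 1 * y).
pose phi (x : R) := S (k * x + - k * y) - S (1 * x + - 1 * y).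
have cbk : continuous bk by exact: continuous_affine_arg.
have cb1 : continuous b1 by exact: continuous_affine_arg.
have phi_out1 x : 1 < `|x - y| -> phi x = 0.
  rewrite /phi; have [xy|xy] := lerP 0 (x - y).
    rewrite ger0_norm// => h; have : x - y <= k * (x - y) by rewrite ler_peMl.
    by move=> h'; rewrite (S1 (k * x + _)) ?(S1 (1 * x + _)) ?subrr//; lra.
  rewrite ltr0_norm// => h; have : k * (x - y) <= x - y by nra.
  by move=> h'; rewrite (S0 (k * x + _)) ?(S0 (1 * x + _)) ?subrr//; lra.
have far x : `|y| + 1 < `|x| -> 1 < `|x - y|.
  by move=> h; have := ler_normD (x - y) y; rewrite subrK; lra.
have phi_out x : `|y| + 1 < `|x| -> phi x = 0 by move=> /far/phi_out1.
have dphi x : is_derive x (1 : R) phi (bk x - b1 x).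
  have := is_derive_affine_arg k (- k * y) dS x.
  have := is_derive_affine_arg 1 (- 1 * y) dS x => ? ?.
  exact: is_deriveB.
have [|tphi phi'] := test_fun_of dphi _ phi_out.
  by move=> x; apply: cvgB; [exact: cbk|exact: cb1].
have phi1 x : `|phi x| <= 1.
  have /andP[? ?] := S01 (k * x + - k * y); have /andP[? ?] := S01 (1 * x + - 1 * y).
  by rewrite /phi ler_norml; apply/andP; split; lra.
have b1_out x : `|y| + 1 < `|x| -> b1 x = 0.
  by move=> /far h; rewrite /b1 eta0 ?mulr0// mul1r mulN1r.
have bk_out' x : e < `|x - y| -> bk x = 0.
  move=> h; rewrite /bk eta0 ?mulr0// mulNr -mulrBr normrM gtr0_norm//.
  by rewrite -ltr_pdivrMl// mulr1 kE.
have bk_out x : `|y| + 1 < `|x| -> bk x = 0.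
  by move=> /far h; apply: bk_out'; exact: le_lt_trans h.
have ib1 : \int[mu]_x b1 x = 1.
  by apply: (Rintegral_bump (S := S)) => //; [exact: S1|exact: S0].
have ibk : \int[mu]_x bk x = 1.
  by apply: (Rintegral_bump (S := S)) => //; [exact: S1|exact: S0].
have lb1 := L2_compact cb1 b1_out; have lbk := L2_compact cbk bk_out.
have lphi := test_fun_L2 tphi.
have int1 f : continuous f -> (forall x, `|y| + 1 < `|x| -> f x = 0) -> integrableT f.
  move=> cf hf; have : integrableT (fun x => cst 1 x * f x).
    apply: locally_integrable_mul cf hf.
    by apply: continuous_locally_integrable; exact: cst_continuous.
  by under [X in integrableT X]eq_fun do rewrite mul1r.
have := Hu _ tphi; rewrite phi'; under eq_Rintegral do rewrite mulrBr.
rewrite RintegralB//; [|exact: L2_mul|exact: L2_mul].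
have Ibk : K <= \int[mu]_x (u x * bk x).
  have -> : K = \int[mu]_x (K * bk x) by rewrite RintegralZl ?ibk ?mulr1//; exact: int1.
  apply: le_Rintegral => //; [exact/integrableTZ/int1|exact: L2_mul|move=> x _].
  have [h|h] := ltP e `|x - y|; first by rewrite bk_out'// !mulr0.
  have /hd/ltW ux : ball y d x by rewrite /ball/= distrC (le_lt_trans h).
  by rewrite ler_wpM2r// mulr_ge0 ?(ltW k0)//; case/andP: (eta_in (k * x + - k * y)).
have Ib1 : \int[mu]_x (u x * b1 x) <= 2^-1 * (\int[mu]_x (u x ^+ 2) + L).
  have i1 := int1 _ cb1 b1_out.
  have <- : \int[mu]_x (2^-1 * (u x ^+ 2 + L * b1 x)) = 2^-1 * (\int[mu]_x (u x ^+ 2) + L).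
    rewrite RintegralZl//; last by apply: integrableTD; [exact: L2_sqr|exact: integrableTZ].
    rewrite RintegralD//; [|exact: L2_sqr|exact: integrableTZ].
    by rewrite RintegralZl// ib1 mulr1.
  apply: le_Rintegral => //; first exact: L2_mul.
    by apply: integrableTZ; apply: integrableTD; [exact: L2_sqr|exact: integrableTZ].
  move=> x _; have : 0 <= b1 x <= L by rewrite /b1 mul1r.
  move=> /andP[p1 p2]; have := sqr_ge0 (u x - b1 x).
  have : b1 x ^+ 2 <= L * b1 x by rewrite expr2 ler_wpM2r.
  nra.
have Iphi : (- \int[mu]_x (v x * phi x)) <= 2^-1 * (\int[mu]_x (v x ^+ 2) + 2).
  pose one (_ : R) : R := 1.
  pose i (x : R) : R := (one \_ `[y - 1, y + 1]) x.
  have ii : integrableT i.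
    apply/integrable_itv_restrict/continuous_integrable_itv; exact: cst_continuous.
  have i2 : \int[mu]_x i x = 2.
    rewrite -Rintegral_mkcond Rintegral_cst//= lebesgue_measure_itv/= lte_fin.
    by rewrite ifT; [rewrite -EFinB/=; ring|lra].
  have <- : \int[mu]_x (2^-1 * (v x ^+ 2 + i x)) = 2^-1 * (\int[mu]_x (v x ^+ 2) + 2).
    rewrite RintegralZl//; last by apply: integrableTD; [exact: L2_sqr|].
    by rewrite RintegralD// ?i2//; exact: L2_sqr.
  rewrite -RintegralN; last exact: L2_mul.
  apply: le_Rintegral => //; first by apply: integrableTN; exact: L2_mul.
    by apply: integrableTZ; apply: integrableTD; [exact: L2_sqr|].
  move=> x _; have phi2 : phi x ^+ 2 <= i x.
    rewrite /i patchE; case: ifPn => [_|].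
      by rewrite -real_normK ?num_real// expr_le1.
    rewrite notin_setE/= in_itv/= => xy.
    rewrite phi_out1 ?expr0n//= ltNge ler_norml; apply/negP => /andP[? ?].
    by apply: xy; apply/andP; split; lra.
  have := sqr_ge0 (v x + phi x); rewrite sqrrD mulr2n; clear -phi2; lra.
move: (lt_le_trans BK Ibk) Ib1 Iphi; rewrite /B.
move: (\int[mu]_x (u x * bk x)) (\int[mu]_x (u x * b1 x)) (\int[mu]_x (v x * phi x)).
move: (\int[mu]_x (u x ^+ 2)) (\int[mu]_x (v x ^+ 2)) => iu iv i1 i2 i3 *; lra.
Qed.

Lemma is_wderiv_bounded u v : continuous u -> u \in L2 -> v \in L2 ->
  is_wderiv u v -> exists2 B, 0 <= B & forall x, `|u x| <= B.
Proof.
move=> cu lu lv Hu.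
have [B1 hB1] := is_wderiv_bounded_above cu lu lv Hu.
have cNu : continuous (fun x => -1 * u x).
  by move=> x; apply: cvgM; [exact: cvg_cst|exact: cu].
have [B2 hB2] := is_wderiv_bounded_above cNu (L2_scale (-1) lu) (L2_scale (-1) lv)
  (is_wderivZ (-1) Hu).
exists (`|B1| + `|B2|); first exact: addr_ge0.
move=> x; have := hB1 x; have := hB2 x; have := ler_norm B1; have := ler_norm B2.
have := normr_ge0 B1; have := normr_ge0 B2.
by rewrite ler_norml => *; apply/andP; split; lra.
Qed.

End square_integrable.

(** * The Euler-Lagrange equation *)

Section euler_lagrange.
Context {R : realType}.
Notation mu := (@lebesgue_measure R).
Local Notation L2 := (Lfun mu 2%:E).

Lemma integrableT_lin3 (a b c : R) (f g h : R -> R) :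
  integrableT f -> integrableT g -> integrableT h ->
  integrableT (fun x => a * f x + b * g x + c * h x).
Proof.
move=> fi gi hi; apply: integrableTD; last exact: integrableTZ.
by apply: integrableTD; exact: integrableTZ.
Qed.

Lemma Rintegral_lin3 (a b c : R) (f g h : R -> R) :
  integrableT f -> integrableT g -> integrableT h ->
  \int[mu]_x (a * f x + b * g x + c * h x) =
  a * (\int[mu]_x f x) + b * (\int[mu]_x g x) + c * (\int[mu]_x h x).
Proof.
move=> fi gi hi; rewrite !RintegralD ?RintegralZl//; try exact: integrableTZ.
by apply: integrableTD; exact: integrableTZ.
Qed.

Variables G G1 G2 : R -> R.
Hypothesis dG : forall s, is_derive s (1 : R) G (G1 s).
Hypothesis dG1 : forall s, is_derive s (1 : R) G1 (G2 s).
Hypothesis cG2 : continuous G2.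
Hypothesis G0 : G 0 = 0.
Hypothesis G10 : G1 0 = 0.

(** [G] vanishes to second order at 0, so it is dominated by a multiple of the square on the bounded
    range of [f]. *)
Lemma comp_integrable (f : R -> R) (B : R) : continuous f -> f \in L2 ->
  (forall x, `|f x| <= B) -> integrableT (fun x => G (f x)).
Proof.
move=> cf lf fB; have [L L0 hL] := taylor2_bound B dG dG1 cG2.
apply: (integrableT_le (g := fun x => L * f x ^+ 2)).
- apply: continuous_measurable => x; apply: (@continuous_comp _ _ _ f G); first exact: cf.
  exact: (is_derive_continuous dG).
- exact/integrableTZ/L2_sqr.
- move=> x; have := hL 0 (f x); rewrite G0 G10 !subr0 mul0r subr0 normr0; apply => //.
  exact: le_trans (fB x).
Qed.

Lemma comp_L2 (f : R -> R) (B : R) : continuous f -> f \in L2 ->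
  (forall x, `|f x| <= B) -> (fun x => G1 (f x)) \in L2.
Proof.
move=> cf lf fB; have [L L0 hL] := continuous_segment_bounded (- B) B cG2.
have cGf : continuous (fun x => G1 (f x)).
  move=> x; apply: (@continuous_comp _ _ _ f G1); first exact: cf.
  exact: (is_derive_continuous dG1).
apply: L2_of_sqr; first exact: continuous_measurable.
apply: (integrableT_le (g := fun x => L ^+ 2 * f x ^+ 2)).
- by apply: measurable_funX; exact: continuous_measurable.
- exact/integrableTZ/L2_sqr.
move=> x; have := fB x; rewrite ler_norml => /andP[f1 f2].
have [c cB E] : exists2 c, - B <= c <= B & G1 (f x) = G2 c * f x.
  have [x0|/ltW x0] := lerP 0 (f x).
    have [c /andP[c1 c2]] := mean_value x0 (fun s _ => dG1 s).
    by rewrite G10 !subr0 => E; exists c => //; apply/andP; split; lra.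
  have [c /andP[c1 c2]] := mean_value x0 (fun s _ => dG1 s).
  rewrite G10 !sub0r mulrN => /oppr_inj E; exists c => //; apply/andP; split; lra.
rewrite ger0_norm ?sqr_ge0// E exprMn ler_wpM2r ?sqr_ge0//.
by rewrite -real_normK ?num_real// ler_pXn2r ?nnegrE// hL.
Qed.

(** The constraint is met by normalizing: the competitor [c t * (q + t * phi)] has mass [lam]. Its
    energy excess is at most the explicit function [r t], so [r] is nonnegative near 0, vanishes at
    0, and has derivative 0 there. Nothing is differentiated under the integral. *)
Lemma euler_lagrange (q v : R -> R) (lam : R) :
  continuous q -> q \in L2 -> v \in L2 -> is_wderiv q v -> 0 < lam ->
  \int[mu]_x (q x ^+ 2) = lam ->
  (forall w dw, continuous w -> w \in L2 -> dw \in L2 -> is_wderiv w dw ->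
    \int[mu]_x (w x ^+ 2) = lam ->
    2^-1 * (\int[mu]_x (v x ^+ 2)) + \int[mu]_x G (q x) <=
    2^-1 * (\int[mu]_x (dw x ^+ 2)) + \int[mu]_x G (w x)) ->
  exists om, is_wderiv v (fun x => G1 (q x) + om * q x).
Proof.
move=> cq lq lv Hq lam0 qlam qmin.
have [B B0 qB] := is_wderiv_bounded cq lq lv Hq.
have cG1 : continuous G1 by exact: (is_derive_continuous dG1).
have lG1q := comp_L2 cq lq qB.
have iGq := comp_integrable cq lq qB.
pose V := \int[mu]_x (v x ^+ 2); pose S := \int[mu]_x (G1 (q x) * q x).
(* The multiplier found by formally testing the equation with [q]: [V + S + om * lam = 0]. *)
pose om := - (V + S) / lam; exists om.
have cG1q : continuous (fun x => G1 (q x)).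
  by move=> x; apply: (@continuous_comp _ _ _ q G1); [exact: cq|exact: cG1].
have cw : continuous (fun x => G1 (q x) + om * q x).
  by move=> x; apply: cvgD; [exact: cG1q|apply: cvgM; [exact: cvg_cst|exact: cq]].
split; [by case: Hq|exact: continuous_locally_integrable|move=> phi tphi].
have cphi := test_fun_continuous tphi.
have lphi := test_fun_L2 tphi; have ldphi := derive_test_fun_L2 tphi.
have [N N0 phiN] := is_wderiv_bounded cphi lphi ldphi (test_fun_is_wderiv tphi).
pose A := \int[mu]_x (q x * phi x); pose P0 := \int[mu]_x (phi x ^+ 2).
pose D := \int[mu]_x (v x * derive1 phi x); pose P := \int[mu]_x (derive1 phi x ^+ 2).
pose T := \int[mu]_x (G1 (q x) * phi x).
have -> : \int[mu]_x ((G1 (q x) + om * q x) * phi x) = T + om * A.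
  have -> : (fun x => (G1 (q x) + om * q x) * phi x) =
      (fun x => G1 (q x) * phi x + om * (q x * phi x)).
    by apply/funext => x; ring.
  by rewrite RintegralD ?RintegralZl//; [exact: L2_mul|exact: L2_mul|exact/integrableTZ/L2_mul].
rewrite -/D.
pose m (t : R) := lam + 2 * t * A + t ^+ 2 * P0.
pose c (t : R) := Num.sqrt (lam / m t).
(* For [|t| <= 1] and [m t > lam / 4] the factor [c t] is at most 2, so the competitors stay within
   this bound. *)
have [L L0 hL] := taylor2_bound (2 * (B + N)) dG dG1 cG2.
(* The last two terms bound the Taylor remainder of [G], with the square of
   [(c t - 1) * q + c t * t * phi] split in two; being of second order at 0, they do not contribute
   to the derivative. *)
pose r (t : R) := 2^-1 * (c t ^+ 2 - 1) * V + c t ^+ 2 * t * D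
  + 2^-1 * c t ^+ 2 * t ^+ 2 * P + (c t - 1) * S + c t * t * T
  + 2 * L * (c t - 1) ^+ 2 * lam + 2 * L * c t ^+ 2 * t ^+ 2 * P0.
have r_ge0 t : `|t| <= 1 -> lam / 4 < m t -> 0 <= r t.
  move=> t1 mt; have mt0 : 0 < m t by rewrite (lt_trans _ mt)// divr_gt0.
  have u0 : 0 <= lam / m t by rewrite divr_ge0// ltW.
  have c2 : c t ^+ 2 = lam / m t by rewrite sqr_sqrtr.
  have c0 : 0 <= c t by exact: sqrtr_ge0.
  have c_le2 : c t <= 2.
    rewrite -(@ler_pXn2r _ 2) ?nnegrE// c2 ler_pdivrMr//; lra.
  pose w x := c t * (q x + t * phi x).
  pose dw x := c t * (v x + t * derive1 phi x).
  have cw' : continuous w.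
    move=> x; apply: cvgM; first exact: cvg_cst.
    by apply: cvgD; [exact: cq|apply: cvgM; [exact: cvg_cst|exact: cphi]].
  have lw : w \in L2 by apply/L2_scale/L2_add => //; exact: L2_scale.
  have ldw : dw \in L2 by apply/L2_scale/L2_add => //; exact: L2_scale.
  have Hw : is_wderiv w dw.
    by apply/is_wderivZ/is_wderivD => //; apply/is_wderivZ/test_fun_is_wderiv.
  have Iw : \int[mu]_x (w x ^+ 2) = lam.
    have -> : (fun x => w x ^+ 2) = (fun x => c t ^+ 2 * q x ^+ 2 +
        2 * t * c t ^+ 2 * (q x * phi x) + t ^+ 2 * c t ^+ 2 * phi x ^+ 2).
      by apply/funext => x; rewrite /w; ring.
    rewrite Rintegral_lin3 ?L2_mul ?L2_sqr// qlam -/A -/P0 c2.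
    by rewrite /m; field; rewrite -/(m t) gt_eqF.
  have Idw : \int[mu]_x (dw x ^+ 2) = c t ^+ 2 * (V + 2 * t * D + t ^+ 2 * P).
    have -> : (fun x => dw x ^+ 2) = (fun x => c t ^+ 2 * v x ^+ 2 +
        2 * t * c t ^+ 2 * (v x * derive1 phi x) + t ^+ 2 * c t ^+ 2 * derive1 phi x ^+ 2).
      by apply/funext => x; rewrite /dw; ring.
    by rewrite Rintegral_lin3 ?L2_mul ?L2_sqr// -/V -/D -/P; ring.
  have wB x : `|w x| <= 2 * (B + N).
    rewrite normrM ger0_norm// ler_pM// (le_trans (ler_normD _ _))// lerD//.
    by rewrite normrM -[N]mul1r ler_pM.
  have qB' x : `|q x| <= 2 * (B + N) by have := qB x; lra.
  have IG : \int[mu]_x G (w x) <= \int[mu]_x G (q x) + (c t - 1) * S + c t * t * T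
      + 2 * L * (c t - 1) ^+ 2 * lam + 2 * L * c t ^+ 2 * t ^+ 2 * P0.
    have i1 : integrableT (fun x => 1 * G (q x) + (c t - 1) * (G1 (q x) * q x) +
        c t * t * (G1 (q x) * phi x)).
      by apply: integrableT_lin3 => //; exact: L2_mul.
    have := Rintegral_lin3 1 (2 * L * (c t - 1) ^+ 2) (2 * L * c t ^+ 2 * t ^+ 2)
      i1 (L2_sqr lq) (L2_sqr lphi).
    rewrite (Rintegral_lin3 1 (c t - 1) (c t * t) iGq (L2_mul lG1q lq) (L2_mul lG1q lphi)).
    rewrite qlam -/P0 -/S -/T !mul1r => <-.
    apply: le_Rintegral => //; first exact: comp_integrable wB.
      by apply: integrableT_lin3 => //; exact: L2_sqr.
    move=> x _; have := hL _ _ (qB' x) (wB x); rewrite ler_norml => /andP[_].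
    have -> : w x - q x = (c t - 1) * q x + c t * t * phi x by rewrite /w; ring.
    set X := (c t - 1) * q x; set Y := c t * t * phi x => h.
    have : L * (X + Y) ^+ 2 <= L * (2 * X ^+ 2 + 2 * Y ^+ 2).
      by rewrite ler_wpM2l//; have := sqr_ge0 (X - Y); rewrite !sqrrD sqrrN mulrN mulNrn; lra.
    rewrite /X /Y in h *; lra.
  have := qmin w dw cw' lw ldw Hw Iw; rewrite Idw -/V /r; lra.
have m0 : m 0 = lam by rewrite /m mulr0 mul0r expr0n/= mul0r !addr0.
have dm t : is_derive t (1 : R) m (2 * A + 2 * t * P0).
  by apply: is_derive_eq; rewrite /GRing.scale/=; ring.
have c0 : c 0 = 1 by rewrite /c m0 divff ?sqrtr1// gt_eqF.
have dc t : 0 < m t -> is_derive t (1 : R) c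
    ((2 * c t)^-1 * (lam * (- (m t) ^- 2 * (2 * A + 2 * t * P0)))).
  move=> mt0; apply: (is_derive_chain (f := fun t => lam / m t)).
    by apply: is_derive1_sqrt; rewrite divr_gt0.
  have dV : is_derive t (1 : R) (fun t => (m t)^-1) (- (m t) ^- 2 *: (2 * A + 2 * t * P0)).
    by apply: is_deriveV; rewrite gt_eqF.
  by apply: is_derive_eq; rewrite /GRing.scale/=.
have dr t d : is_derive t (1 : R) c d -> is_derive t (1 : R) r
    (c t * d * V + (2 * c t * d * t + c t ^+ 2) * D
     + (c t * d * t ^+ 2 + c t ^+ 2 * t) * P + d * S + (d * t + c t) * T
     + 4 * L * (c t - 1) * d * lam
     + 4 * L * (c t * d * t ^+ 2 + c t ^+ 2 * t) * P0).
  by move=> ?; apply: is_derive_eq; rewrite /GRing.scale/=; field.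
have cm : {for (0 : R), continuous m}.
  by apply/differentiable_continuous/derivable1_diffP; case: (dm 0).
have : \forall t \near (0 : R), lam / 4 < m t.
  have /cvgr_gt := cm; apply; rewrite m0; lra.
move/nbhs_ballP => -[e0 /= e00 he0].
pose e := Num.min e0 1.
have e_gt0 : 0 < e by rewrite lt_min e00/=.
have near_m t : t \in `]- e, e[%R -> `|t| <= 1 /\ lam / 4 < m t.
  rewrite in_itv/= -ltr_norml lt_min => /andP[te0 /ltW t1]; split=> //.
  by apply: he0; rewrite /ball/= sub0r normrN.
have mpos t : lam / 4 < m t -> 0 < m t by apply: lt_trans; rewrite divr_gt0.
have r0 : r 0 = 0 by rewrite /r c0 expr1n; ring.
have dr0 : is_derive (0 : R) (1 : R) r 0.
  apply: (derive1_at_min (a := - e) (b := e)).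
  - lra.
  - by move=> t /near_m[_ /mpos/dc/dr]; case.
  - by rewrite in_itv/= oppr_lt0 e_gt0.
  - by move=> t /near_m[? ?]; rewrite r0 r_ge0.
have m00 : 0 < m 0 by rewrite m0.
have := is_derive_unique dr0 (dr _ _ (dc _ m00)).
rewrite c0 m0 /om.
have -> : (2 * 1)^-1 * (lam * (- lam ^- 2 * (2 * A + 2 * 0 * P0))) = - A / lam.
  by field; rewrite gt_eqF.
have lam_neq0 := lt0r_neq0 lam0.
move=> h; have E : D = (V + S) * (A / lam) - T.
  move: h; rewrite subrr !mulr0 expr1n expr0n/= !mulr0; lra.
by rewrite E; field.
Qed.

End euler_lagrange.

(** * Finite mass solutions *)

Section solutions.
Context {R : realType}.
Notation mu := (@lebesgue_measure R).
Local Notation L2 := (Lfun mu 2%:E).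

(** The line has infinite measure. This is how integrability kills the Hamiltonian, positive lower
    bounds and limits at infinity. *)
Lemma integrableT_cst (c : R) : integrableT (fun _ : R => c) -> c = 0.
Proof.
move=> /integrableP[_]; rewrite integral_cst//=.
have -> : mu setT = +oo%E by rewrite -set_itvNyy lebesgue_measure_itv.
have [->//|c0] := eqVneq c 0.
by rewrite gt0_muley ?lte_fin ?normr_gt0.
Qed.

(** Bootstrap: [v] has a C^1 representative, hence so does [q], which equals it everywhere by
    continuity. *)
Lemma wderiv2_regular (q v w : R -> R) : continuous q -> v \in L2 ->
  is_wderiv q v -> is_wderiv v w -> continuous w ->
  exists V, [/\ forall x, is_derive x (1 : R) q (V x),
    forall x, is_derive x (1 : R) V (w x), V \in L2 &
    {ae mu, forall x, v x = V x}].
Proof.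
move=> cq lv Hq Hv cw; have [V dV vV] := wderiv_continuous_regular Hv cw.
have cV : continuous V by exact: (is_derive_continuous dV).
have HqV := is_wderiv_ae Hq (continuous_locally_integrable cV) vV.
have [Q dQ qQ] := wderiv_continuous_regular HqV cV.
have cQ : continuous Q by exact: (is_derive_continuous dQ).
have E : q = Q by exact: ae_eq_continuous.
exists V; split=> //; first by move=> x; rewrite E.
apply: L2_of_sqr; first exact: continuous_measurable.
apply: integrableT_ae (L2_sqr lv) _.
  by apply: measurable_funX; exact: continuous_measurable.
apply: filterS vV; first exact: (ae_filter_ringOfSetsType mu).
by move=> x ->.
Qed.

Lemma even_primitive_odd (f F : R -> R) :
  (forall x, is_derive x (1 : R) F (f x)) -> (forall x, f (- x) = f x) ->
  F 0 = 0 -> forall x, F (- x) = - F x.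
Proof.
move=> dF ef F0 x; apply/eqP; rewrite -addr_eq0; apply/eqP.
have d y : is_derive y (1 : R) (fun y => F (- y) + F y) 0.
  have d1 : is_derive y (1 : R) (fun y => F (- y)) (f (- y) * - 1).
    by apply: (is_derive_chain (f := -%R)); exact: dF.
  have := dF y => ?; apply: is_derive_eq; rewrite ef; ring.
by rewrite (is_derive_0_is_cst (f := fun y => F (- y) + F y) x 0 d) oppr0 F0 addr0.
Qed.

(** By oddness, [F u] is half the integral of [f] over [[- u, u]]. *)
Lemma even_primitive_cvg (f F : R -> R) : continuous f -> integrableT f ->
  (forall x, is_derive x (1 : R) F (f x)) -> (forall x, f (- x) = f x) ->
  F 0 = 0 -> F x @[x --> +oo] --> 2^-1 * \int[mu]_x f x.
Proof.
move=> cf fi dF ef F0; apply/cvg_pinftyP => u uoo.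
have oddF := even_primitive_odd dF ef F0.
pose g n : R -> R := f \_ `[- u n, u n].
have [||||_] := @Rintegral_dominated_cvg R g f (fun x => `|f x|).
- move=> n; apply: integrableT_measurable.
  exact/integrable_itv_restrict/continuous_integrable_itv.
- move=> x; apply: cvg_near_cst; move/cvgryPge : uoo => /(_ `|x|).
  apply: filterS => n xu; rewrite /g patchE ifT// inE/= in_itv/= -ler_norml//.
- exact: integrable_norm.
- by move=> n x; rewrite /g patchE; case: ifPn => //; rewrite normr0.
move=> h; have : 2^-1 * (\int[mu]_x g n x) @[n --> \oo] --> 2^-1 * \int[mu]_x f x.
  by apply: cvgM => //; exact: cvg_cst.
apply: cvg_trans; apply: near_eq_cvg; move/cvgryPge : uoo => /(_ 0).
apply: filterS => n u0; rewrite /g -Rintegral_mkcond (Rintegral_FTC cf dF).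
  by rewrite oddF /=; field.
by rewrite ge0_cp.
Qed.

Variables G G1 G2 : R -> R.
Hypothesis dG : forall s, is_derive s (1 : R) G (G1 s).
Hypothesis dG1 : forall s, is_derive s (1 : R) G1 (G2 s).
Hypothesis cG2 : continuous G2.
Hypothesis Geven : forall s, G (- s) = G s.
Hypothesis G0 : G 0 = 0.
Hypothesis G20 : G2 0 = 0.

Lemma even_derive_odd (s : R) : G1 (- s) = - G1 s.
Proof.
have d1 : is_derive s (1 : R) (fun y => G (- y)) (G1 (- s) * - 1).
  by apply: (is_derive_chain (f := -%R)); exact: dG.
have E : (fun y => G (- y)) = G by apply/funext.
rewrite E in d1; have := is_derive_unique d1 (dG s); lra.
Qed.

Lemma even_derive2_even (s : R) : G2 (- s) = G2 s.
Proof.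
have d1 : is_derive s (1 : R) (fun y => G1 (- y)) (G2 (- s) * - 1).
  by apply: (is_derive_chain (f := -%R)); exact: dG1.
have E : (fun y => G1 (- y)) = (fun y => - G1 y) by apply/funext => y; exact: even_derive_odd.
rewrite E in d1; have d2 : is_derive s (1 : R) (fun y => - G1 y) (- G2 s).
  by have := dG1 s => ?; exact: is_deriveN.
by have := is_derive_unique d1 d2; lra.
Qed.

Lemma even_derive0 : G1 0 = 0.
Proof. by have := even_derive_odd 0; rewrite oppr0; lra. Qed.

Section one_solution.
Variables (w : R) (q V : R -> R).
Hypothesis dq : forall x, is_derive x (1 : R) q (V x).
Hypothesis dV : forall x, is_derive x (1 : R) V (G1 (q x) + w * q x).
Hypothesis lq : q \in L2.
Hypothesis lV : V \in L2.
Variable B : R.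
Hypothesis qB : forall x, `|q x| <= B.

Let cq : continuous q. Proof. exact: (is_derive_continuous dq). Qed.
Let cV : continuous V. Proof. exact: (is_derive_continuous dV). Qed.

(** The Hamiltonian is constant by the equation and integrable by finite mass, hence 0. *)
Lemma solution_energy (x : R) : V x ^+ 2 = 2 * G (q x) + w * q x ^+ 2.
Proof.
pose H x := V x ^+ 2 - 2 * G (q x) - w * q x ^+ 2.
have dH y : is_derive y (1 : R) H 0.
  have := dq y; have := dV y; have := is_derive_chain (dG (q y)) (dq y) => ? ? ?.
  by apply: is_derive_eq; rewrite /GRing.scale/=; ring.
suff : H x = 0 by rewrite /H; lra.
apply: integrableT_cst.
have -> : (fun _ => H x) = (fun y => 1 * V y ^+ 2 + - 2 * G (q y) + - w * q y ^+ 2).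
  by apply/funext => y; rewrite (is_derive_0_is_cst (f := H) x y dH) /H; ring.
apply: integrableT_lin3; [exact: L2_sqr| |exact: L2_sqr].
exact: (comp_integrable dG dG1 cG2 G0 even_derive0 cq lq qB).
Qed.

Lemma solution_small (e : R) : 0 < e -> exists x, `|q x| < e.
Proof.
move=> e0; apply: contrapT => h.
have : e ^+ 2 = 0.
  apply: integrableT_cst; apply: integrableT_le (L2_sqr lq) _.
    exact: measurable_cst.
  move=> x; rewrite ger0_norm ?sqr_ge0// -[leRHS]real_normK ?num_real//.
  rewrite ler_pXn2r ?nnegrE//; last exact: ltW.
  by rewrite leNgt; apply/negP => qe; apply: h; exists x.
by move/eqP; rewrite expf_eq0/= gt_eqF.
Qed.

(** The energy identity bounds [|V|] by a multiple of [|q|], so Gronwall applies with no condition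
    on [V x0]. *)
Lemma solution_nonvanishing (x0 : R) : q x0 = 0 -> forall x, q x = 0.
Proof.
have [L L0 hL] := taylor2_bound B dG dG1 cG2.
apply: (linear_growth_zero (df := V) (L := 2 * L + `|w| + 1) dq) => x.
have := hL 0 (q x); rewrite G0 even_derive0 normr0 !subr0 mul0r subr0 => hG.
have {}hG : `|G (q x)| <= L * q x ^+ 2.
  by apply: hG => //; exact: le_trans (qB x).
have V2 : V x ^+ 2 <= (2 * L + `|w| + 1) ^+ 2 * q x ^+ 2.
  have := solution_energy x; have := sqr_ge0 (q x); have := ler_norm w.
  have := ler_norm (G (q x)); have := normr_ge0 w; move: hG.
  move: (`|w| : R) (q x ^+ 2 : R) => W z hG W0 hG' wW z0 E.
  have : w * z <= W * z by rewrite ler_wpM2r.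
  have : (2 * L + W) * z <= (2 * L + W + 1) ^+ 2 * z.
    by rewrite ler_wpM2r//; nra.
  lra.
rewrite -(@ler_pXn2r _ 2) ?nnegrE ?mulr_ge0//; last by rewrite !addr_ge0// mulr_ge0.
by rewrite exprMn !real_normK ?num_real.
Qed.

Hypothesis q_even : forall x, q (- x) = q x.
Hypothesis hG3 : forall x,
  0 <= 12 * G (q x) - 7 * q x * G1 (q x) + q x ^+ 2 * G2 (q x).

Lemma solution_profile : (forall x, 0 < q x) -> profile G G1 G2 w q V.
Proof.
move=> q0; split=> //; last exact: solution_energy.
- by move=> e /solution_small[x]; rewrite gtr0_norm//; exists x.
- by exists B => x; rewrite (le_trans (ler_norm _)).
Qed.

(** The primitive [P] of the energy density tends to half the energy; being integrable, as a product
    of square integrable functions, it can only tend to 0. *)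
Lemma critical_zero_energy : (forall x, 0 < q x) ->
  (forall x, q x * G1 (q x) = 6 * G (q x)) ->
  2^-1 * (\int[mu]_x (V x ^+ 2)) + \int[mu]_x G (q x) = 0.
Proof.
move=> q0 crit; have pq := solution_profile q0.
have iG := comp_integrable dG dG1 cG2 G0 even_derive0 cq lq qB.
pose e x := 2^-1 * V x ^+ 2 + G (q x).
have -> : 2^-1 * (\int[mu]_x (V x ^+ 2)) + \int[mu]_x G (q x) = \int[mu]_x e x.
  by rewrite RintegralD ?RintegralZl//; [exact: L2_sqr|exact/integrableTZ/L2_sqr].
pose P x := q x * V x / 4.
have dP x : is_derive x (1 : R) P (e x).
  have := dq x; have := dV x => ? ?; apply: is_derive_eq; rewrite /GRing.scale/= /e.
  have := solution_energy x; have := crit x; set y := q x; set z := V x; nra.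
have ce : continuous e.
  move=> x; apply: cvgD.
    by apply: cvgM; [exact: cvg_cst|apply: cvgM; exact: cV].
  by apply: (@continuous_comp _ _ _ q G); [exact: cq|exact: (is_derive_continuous dG)].
have ie : integrableT e by apply: integrableTD => //; exact/integrableTZ/L2_sqr.
have ee x : e (- x) = e x by rewrite /e q_even (profile_V_odd pq) sqrrN.
have P0 : P 0 = 0 by rewrite /P (profile_V0 pq) mulr0 mul0r.
have Poo := even_primitive_cvg ce ie dP ee P0.
set l := 2^-1 * \int[mu]_x e x in Poo.
suff : l = 0 by rewrite /l; lra.
apply/eqP; rewrite -normr_eq0; apply/eqP.
suff : `|l| / 2 = 0 by lra.
apply: integrableT_cst.
have oddP := even_primitive_odd dP ee P0.
have [l0|l_neq0] := eqVneq l 0.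
  rewrite l0 normr0 mul0r.
  have -> : (fun _ : R => 0 : R) = (fun x => 0 * e x) by apply/funext => x; rewrite mul0r.
  exact: integrableTZ.
have /cvgrPdist_lt/(_ (`|l| / 2)) := Poo.
rewrite divr_gt0 ?normr_gt0// => /(_ isT)[A [_ hA]].
pose hl (_ : R) : R := `|l| / 2.
(* Outside [[- A, A]] the first term exceeds [|l| / 2]; the second takes care of the segment. *)
apply: (integrableT_le (g := fun x => `|P x| + `|(hl \_ `[- A, A]) x|)).
- exact: measurable_cst.
- apply: integrableTD; apply: integrable_norm.
    have -> : EFin \o P = EFin \o (fun x => 4^-1 * (q x * V x)).
      by apply/funext => x /=; rewrite /P mulrC.
    exact/integrableTZ/L2_mul.
  apply/integrable_itv_restrict/continuous_integrable_itv; exact: cst_continuous.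
- move=> x; rewrite ger0_norm; last by rewrite divr_ge0.
  rewrite patchE; case: ifPn => [_|].
    by rewrite [X in _ + X]ger0_norm ?divr_ge0// lerDr.
  rewrite notin_setE/= in_itv/= -ler_norml => /negP; rewrite -ltNge => /hA.
  have -> : `|P x| = `|P `|x| |.
    by case: (ger0P x) => // _; rewrite oddP normrN.
  have := ler_normD (l - P `|x|) (P `|x|); rewrite subrK normr0; lra.
Qed.

End one_solution.

Lemma solution_neg (w : R) (q V : R -> R) :
  (forall x, is_derive x (1 : R) q (V x)) ->
  (forall x, is_derive x (1 : R) V (G1 (q x) + w * q x)) ->
  (forall x, is_derive x (1 : R) (fun x => - q x) (- V x)) /\
  (forall x, is_derive x (1 : R) (fun x => - V x) (G1 (- q x) + w * - q x)).
Proof.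
move=> dq dV; split=> x; first by have := dq x => ?; exact: is_deriveN.
by have := dV x => ?; apply: is_derive_eq; rewrite even_derive_odd; ring.
Qed.

(** In the second case of [profile_unique], [gamma] is constant below the larger height, so it is
    the taller profile [q2] whose energy vanishes. *)
Lemma profile_mass_unique (w1 w2 : R) (q1 q2 V1 V2 : R -> R) :
  profile G G1 G2 w1 q1 V1 -> profile G G1 G2 w2 q2 V2 ->
  q1 \in L2 -> q2 \in L2 -> V2 \in L2 ->
  \int[mu]_x (q1 x ^+ 2) = \int[mu]_x (q2 x ^+ 2) ->
  2^-1 * (\int[mu]_x (V2 x ^+ 2)) + \int[mu]_x G (q2 x) != 0 ->
  q1 0 <= q2 0 -> q1 = q2.
Proof.
move=> p1 p2 lq1 lq2 lV2 mE E0 le12.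
have prim q w V : profile G G1 G2 w q V -> q \in L2 -> exists M,
    [/\ forall x, is_derive x (1 : R) M (q x ^+ 2), M 0 = 0 &
     M x @[x --> +oo] --> 2^-1 * \int[mu]_x (q x ^+ 2)].
  move=> pq lq; have cq := profile_continuous pq.
  have cq2 : continuous (fun x => q x ^+ 2) by move=> x; apply: cvgM; exact: cq.
  have [M dM] := exists_primitive cq2.
  have dM' x : is_derive x (1 : R) (fun x => M x - M 0) (q x ^+ 2).
    by have := dM x => ?; apply: is_derive_eq; rewrite subr0.
  exists (fun x => M x - M 0); split=> //; first by rewrite subrr.
  apply: even_primitive_cvg cq2 (L2_sqr lq) dM' _ _; last by rewrite subrr.
  by move=> x; rewrite (profile_even pq).
have [M1 [dM1 M10 M1l]] := prim _ _ _ p1 lq1.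
have [M2 [dM2 M20 M2l]] := prim _ _ _ p2 lq2.
rewrite mE in M1l.
have [//|gE] := profile_unique dG dG1 cG2 p1 p2 le12 dM1 dM2 M10 M20 M1l M2l.
have crit := gamma_constant_critical dG dG1 cG2 G0 even_derive0 G20 (profile_gt0 p2 0) gE.
have [B hB] := profile_bounded p2.
have q2B x : `|q2 x| <= B by rewrite gtr0_norm ?hB// (profile_gt0 p2).
exfalso; move/eqP: E0; apply.
apply: (critical_zero_energy (profile_q p2) (profile_V p2) lq2 lV2 q2B (profile_even p2)
  (profile_G3 p2) (profile_gt0 p2)) => x.
by apply: crit; rewrite (profile_gt0 p2)/= (profile_le_top dG dG1 cG2 p2).
Qed.

End solutions.

(** * Minimizers *)

Section minimizers.
Context {R : realType}.
Notation mu := (@lebesgue_measure R).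
Local Notation L2 := (Lfun mu 2%:E).
Variables G G1 G2 : R -> R.
Hypothesis dG : forall s, is_derive s (1 : R) G (G1 s).
Hypothesis dG1 : forall s, is_derive s (1 : R) G1 (G2 s).
Hypothesis cG2 : continuous G2.
Hypothesis Geven : forall s, G (- s) = G s.
Hypothesis G0 : G 0 = 0.
Hypothesis G20 : G2 0 = 0.

Let G10 : G1 0 = 0. Proof. exact: even_derive0 dG Geven. Qed.

Definition complexify (q : R -> R) (x : R) : R[i] := Complex (q x) 0.

Lemma H1_cst0 : H1 (cst 0 : R -> R).
Proof.
have c0 : continuous (cst 0 : R -> R) by move=> x; exact: cvg_cst.
have l0 : (cst 0 : R -> R) \in L2 by apply: (@L2_compact _ _ 0).
by split=> //; exists (cst 0) => //; apply: is_derive_is_wderiv.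
Qed.

(** [wderiv] chooses an arbitrary weak derivative; it is square integrable because it agrees almost
    everywhere with the one supplied by [H1]. *)
Lemma H1_wderiv (q : R -> R) : H1 q ->
  is_wderiv q (wderiv q) /\ wderiv q \in L2.
Proof.
move=> [cq lq [v lv Hv]].
have Hq : is_wderiv q (wderiv q).
  by rewrite /wderiv; case: xgetP => [v' _ //|/(_ v)].
split=> //; have [_ [mw _ _] _] := Hq; apply: L2_of_sqr => //.
apply: integrableT_ae (L2_sqr lv) _; first exact: measurable_funX.
apply: filterS (is_wderiv_unique Hv Hq); first exact: (ae_filter_ringOfSetsType mu).
by move=> x ->.
Qed.

Lemma normc_sqr (a b : R) : Normc.normc (Complex a b) ^+ 2 = a ^+ 2 + b ^+ 2.
Proof. by rewrite /= sqr_sqrtr// addr_ge0// sqr_ge0. Qed.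

Lemma G_normc (a : R) : F G (Complex a 0) = G a.
Proof.
rewrite /F /= expr0n/= addr0 sqrtr_sqr.
by case: (ger0P a).
Qed.

Lemma integral_EFin (f : R -> R) : integrableT f ->
  (\int[mu]_x (f x)%:E = (\int[mu]_x f x)%R%:E)%E.
Proof. by move=> fi; rewrite /Rintegral fineK//; exact: integrable_fin_num. Qed.

Lemma mass_complexify (q : R -> R) : q \in L2 ->
  mass (complexify q) = (\int[mu]_x (q x ^+ 2))%R%:E.
Proof.
move=> lq; rewrite -integral_EFin; last exact: L2_sqr.
by apply: eq_integral => x _; rewrite normc_sqr expr0n addr0.
Qed.

Lemma H1C_complexify (q : R -> R) : H1 q -> H1C (complexify q).
Proof. by move=> Hq; split; [exact: Hq|exact: H1_cst0]. Qed.

Lemma energy_complexify (q v : R -> R) : H1 q -> v \in L2 -> is_wderiv q v ->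
  energy G (complexify q) =
  (2^-1 * (\int[mu]_x (v x ^+ 2)) + \int[mu]_x G (q x))%R%:E.
Proof.
move=> H1q lv Hv; have [cq lq _] := H1q.
have [Hq lw] := H1_wderiv H1q; have [H0 l0] := H1_wderiv H1_cst0.
have [B _ qB] := is_wderiv_bounded cq lq lv Hv.
have iG := comp_integrable dG dG1 cG2 G0 G10 cq lq qB.
rewrite EFinD EFinM -!integral_EFin//; last exact: L2_sqr.
rewrite /energy; congr (_ * _ + _)%E.
  (* The chosen weak derivative of the imaginary part is known to be 0 only almost everywhere. *)
  have E0 : {ae mu, forall x, wderiv (cst 0 : R -> R) x = 0}.
    apply: (is_wderiv_unique H0); apply: is_derive_is_wderiv.
    by move=> x; exact: cvg_cst.
  under eq_integral do rewrite normc_sqr.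
  apply: ae_eq_integral => //.
  - apply/measurable_EFinP; apply: measurable_funD; apply: measurable_funX.
      exact: L2_measurable lw.
    exact: L2_measurable l0.
  - by apply/measurable_EFinP; apply: measurable_funX; exact: L2_measurable.
  - apply: filterS2 (is_wderiv_unique Hq Hv) E0; first exact: (ae_filter_ringOfSetsType mu).
    move=> x e1 e2 _; congr EFin.
    by rewrite -e1; move: e2; rewrite /comp/= => ->; rewrite expr0n addr0.
by apply: eq_integral => x _; rewrite G_normc.
Qed.

Lemma real_minimizer (lam : R) (u : R -> R[i]) :
  minimizers G lam u -> H1r u -> exists q, [/\ u = complexify q, H1 q,
    forall x, q (- x) = q x, \int[mu]_x (q x ^+ 2) = lam &
    forall v, v \in L2 -> is_wderiv q v ->
    (2^-1 * (\int[mu]_x (v x ^+ 2)) + \int[mu]_x G (q x))%:E = inf_energy G lam].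
Proof.
move=> [[uH um] ue] [_ uim uev].
pose q := @complex.Re R \o u.
have uq : u = complexify q.
  apply/funext => x; rewrite /complexify /q /= -(uim x); by case: (u x).
have Hq : H1 q by case: uH.
have [cq lq _] := Hq.
exists q; split=> //.
- by move=> x; rewrite /q /= uev.
- by move: um; rewrite uq mass_complexify// => -[].
- by move=> v lv Hv; rewrite -ue uq (energy_complexify Hq lv Hv).
Qed.

Variable lam : R.
Hypothesis lam_gt0 : 0 < lam.
Hypothesis inf_neq0 : inf_energy G lam <> 0%E.
Hypothesis hG3 : forall (om : R) (Q : R -> R), H1 Q ->
  is_wderiv (wderiv Q) (fun x => G1 (Q x) + om * Q x) -> forall x,
  0 <= 12 * G (Q x) - 7 * Q x * G1 (Q x) + Q x ^+ 2 * G2 (Q x).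

(** A zero of [q] would make [q] and its mass vanish, so [q] has constant sign; if it is negative,
    [- q] solves the same equation since [G1] is odd. *)
Lemma minimizer_profile (u : R -> R[i]) : minimizers G lam u -> H1r u ->
  exists om q V, [/\ u = complexify q \/ u = complexify (fun x => - q x),
    profile G G1 G2 om q V, q \in L2 /\ V \in L2, \int[mu]_x (q x ^+ 2) = lam &
    2^-1 * (\int[mu]_x (V x ^+ 2)) + \int[mu]_x G (q x) != 0].
Proof.
move=> umin ur; have [q [uq Hq q_even qlam qE]] := real_minimizer umin ur.
have [cq lq _] := Hq; have [Hv lv] := H1_wderiv Hq.
have [om Hom] : exists om, is_wderiv (wderiv q) (fun x => G1 (q x) + om * q x).
  apply: (euler_lagrange dG dG1 cG2 G0 G10 cq lq lv Hv lam_gt0 qlam).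
  move=> w dw cw lw ldw Hw wlam.
  have H1w : H1 w by split=> //; exists dw.
  rewrite -lee_fin (qE _ lv Hv) -(energy_complexify H1w ldw Hw).
  apply: ereal_inf_lbound; exists (complexify w) => //.
  by split; [exact: H1C_complexify|rewrite mass_complexify// wlam].
have G3q := hG3 Hq Hom.
have cG1 : continuous G1 by exact: (is_derive_continuous dG1).
have cw : continuous (fun x => G1 (q x) + om * q x).
  move=> x; apply: cvgD; last by apply: cvgM; [exact: cvg_cst|exact: cq].
  by apply: (@continuous_comp _ _ _ q G1); [exact: cq|exact: cG1].
have [V [dq dV lV vV]] := wderiv2_regular cq lv Hv Hom cw.
have HV : is_wderiv q V.
  by apply: is_derive_is_wderiv => //; exact: (is_derive_continuous dV).
have [B B0 qB] := is_wderiv_bounded cq lq lV HV.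
have E0 : 2^-1 * (\int[mu]_x (V x ^+ 2)) + \int[mu]_x G (q x) != 0.
  by apply/eqP => E; apply: inf_neq0; rewrite -(qE _ lV HV) E.
have q_neq0 x : q x != 0.
  apply/eqP => qx; move: lam_gt0; rewrite -qlam.
  have q0 := solution_nonvanishing dG dG1 cG2 Geven G0 dq dV lq lV qB qx.
  under eq_Rintegral do rewrite q0 expr0n/=.
  by rewrite Rintegral_cst// mul0r ltxx.
have same x : 0 <= q 0 * q x by exact: nonvanishing_same_sign.
have [q0|q0|q0] := ltgtP (q 0) 0.
- have [dq' dV'] := solution_neg dG Geven dq dV.
  have qneg x : 0 < - q x.
    by rewrite oppr_gt0 lt_neqAle q_neq0/= -(nmulr_rge0 _ q0).
  have lq' := L2_opp lq; have lV' := L2_opp lV.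
  have qB' x : `|- q x| <= B by rewrite normrN.
  have q_even' x : - q (- x) = - q x by rewrite q_even.
  have G3' x : 0 <= 12 * G (- q x) - 7 * (- q x) * G1 (- q x) + (- q x) ^+ 2 * G2 (- q x).
    rewrite Geven (even_derive_odd dG Geven) (even_derive2_even dG dG1 Geven).
    by rewrite sqrrN [7 * - _]mulrN mulrNN.
  exists om, (fun x => - q x), (fun x => - V x); split=> //.
  + by right; rewrite uq; congr complexify; apply/funext => x; rewrite opprK.
  + exact: (solution_profile dG dG1 cG2 Geven G0 dq' dV' lq' lV' qB' q_even' G3').
  + by under eq_Rintegral do rewrite sqrrN.
  + under eq_Rintegral do rewrite sqrrN.
    by under [X in _ + X]eq_Rintegral do rewrite Geven.
- have qpos x : 0 < q x.
    by rewrite lt_neqAle eq_sym q_neq0/= -(pmulr_rge0 _ q0).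
  exists om, q, V; split=> //; first by left.
  exact: (solution_profile dG dG1 cG2 Geven G0 dq dV lq lV qB q_even G3q).
- by have := q_neq0 0; rewrite q0 eqxx.
Qed.

Lemma minimizers_real_finite : finite_set (minimizers G lam `&` @H1r R).
Proof.
have [E|/set0P[u0 [m0 r0]]] := eqVneq (minimizers G lam `&` @H1r R) set0.
  by rewrite E; exact: finite_set0.
have [om0 [q0 [V0 [_ p0 [lq0 lV0] m0E e0]]]] := minimizer_profile m0 r0.
apply: (@sub_finite_set _ _ [set complexify q0; complexify (fun x => - q0 x)]).
  move=> u [um ur].
  have [om [q [V [uq p [lq lV] mE e]]]] := minimizer_profile um ur.
  have mm : \int[mu]_x (q x ^+ 2) = \int[mu]_x (q0 x ^+ 2) by rewrite mE m0E.
  suff <- : q = q0 by [].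
  have [le|/ltW le] := lerP (q 0) (q0 0).
    exact: (profile_mass_unique dG dG1 cG2 Geven G0 G20 p p0 lq lq0 lV0 mm e0 le).
  symmetry.
  exact: (profile_mass_unique dG dG1 cG2 Geven G0 G20 p0 p lq0 lq lV (esym mm) e le).
by rewrite finite_setU; split; exact: finite_set1.
Qed.

End minimizers.

Unset Implicit Arguments.

Theorem corollary3p1 (R : realType) (f : R[i] -> R[i]) (G : R -> R)
    (hfC1 : real_C1 f)
    (hfconj : forall s : R[i], f (conjc s) = conjc (f s))
    (hfphase : forall s z : R[i], `|z| = 1 -> f (z * s) = z * f s)
    (hG0 : G 0 = 0)
    (hGf : forall x : R, is_derive x 1 G (complex.Re (f (Complex x 0))))
    (hG1 : exists s0 : R, G s0 < 0)
    (C p q ps ss : R)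
    (hC : 0 < C) (hps2 : 2 < ps) (hps6 : ps < 6) (hp : 2 < p) (hpq : p <= q)
    (hG2 : forall s : R,
      `|derive1 G s| <= C * (`|s| `^ (p - 1) + `|s| `^ (q - 1)))
    (hG2' : forall s : R, ss <= s -> - C * `|s| `^ (ps - 1) <= derive1 G s)
    (hG3C2 : C2 G)
    (hG3 : forall (omega : R) (Q : R -> R), H1 Q -> solves G omega Q ->
      forall x : R,
        0 <= 12 * G (Q x) - 7 * Q x * derive1 G (Q x) +
          Q x ^+ 2 * derive1n 2 G (Q x))
    (C' : R) (hC' : 0 < C')
    (hG4 : forall s : R,
      `|derive1n 2 G s| <= C' * (`|s| `^ (p - 2) + `|s| `^ (q - 2)))
    (lambda : R) (hlambda : (lambda_star G < lambda%:E)%E) :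
  finite_set (minimizers G lambda `&` @H1r R).
Proof.
pose G1 := derive1 G; pose G2 := derive1n 2 G.
have dG s : is_derive s (1 : R) G (G1 s).
  by rewrite /G1 derive1E; case: hG3C2 => h _ _; exact/derivableP.
have dG1 s : is_derive s (1 : R) G1 (G2 s).
  by rewrite /G2 /= derive1E; case: hG3C2 => _ h _; exact/derivableP.
have cG2 : continuous G2 by case: hG3C2.
have odd s : G1 (- s) = - G1 s.
  rewrite (is_derive_unique (dG (- s)) (hGf (- s))).
  rewrite (is_derive_unique (dG s) (hGf s)).
  (* The phase invariance of [f] is used with the unimodular number -1. *)
  have -> : Complex (- s) 0 = -1 * Complex s 0.
    by rewrite mulN1r; apply/eqP; rewrite eq_complex/= oppr0 !eqxx.
  rewrite hfphase; last by rewrite normrN1.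
  by rewrite mulN1r; case: (f _).
have Geven s : G (- s) = G s.
  apply/eqP; rewrite -subr_eq0; apply/eqP.
  have d y : is_derive y (1 : R) (fun y => G (- y) - G y) 0.
    have d1 : is_derive y (1 : R) (fun y => G (- y)) (G1 (- y) * - 1).
      by apply: (is_derive_chain (f := -%R)); exact: dG.
    by have := dG y => ?; apply: is_derive_eq; rewrite odd; ring.
  by rewrite (is_derive_0_is_cst (f := fun y => G (- y) - G y) s 0 d) oppr0 subrr.
(* The exponents in (G4) are positive, so its right-hand side vanishes at 0. *)
have G20 : G2 0 = 0.
  apply/eqP; rewrite -normr_le0; have := hG4 0.
  rewrite normr0 !powR0 ?addr0 ?mulr0//; lra.
have lam0 : 0 < lambda.
  rewrite -lte_fin; apply: le_lt_trans hlambda.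
  by apply: ereal_sup_ubound; left.
apply: (minimizers_real_finite dG dG1 cG2 Geven hG0 G20 lam0).
(* If the infimum were 0, [lambda] would belong to the set of which [lambda_star G] is the
   supremum. *)
- move=> I0; move: hlambda; apply/negP; rewrite -leNgt.
  by apply: ereal_sup_ubound; right; exists lambda.
- by move=> om Q HQ sQ x; exact: hG3 om Q HQ sQ x.
Qed.
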